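(* Suppose that $(X_n,\eta_n)$ is a time-homogeneous, irreducible Markov chain on the half strip $\Sigma$ and that all of the following hold. (1) For some $p>2$ there is a constant $C_p<\infty$ such that $\mathbb{E}_{x,i}[|X_{n+1}-X_n|^p]\le C_p$ for all $(x,i)\in\Sigma$ and all $n$. (2) For all $i,j\in S$ the limit $q_{ij}=\lim_{x\to\infty}q_{ij}(x)$ exists, and $(q_{ij})_{i,j\in S}$ is an irreducible stochastic matrix; let $(\pi_i)_{i\in S}$ be its unique stationary distribution. (3) For each $i\in S$ there exist $c_i\in\mathbb{R}$ and $s_i^2\in[0,\infty)$, with at least one $s_i^2$ non-zero, such that, as $x\to\infty$, $\mu_i(x)=\frac{c_i}{x}+o(x^{-1})$ and $\sigma_i^2(x)=s_i^2+o(1)$. If for some $\theta>0$, $$\sum_{i\in S}\left[2c_i+(2\theta-1)s_i^2\right]\pi_i<0,$$ then for any $s\in\left[0,\theta\wedge\frac p2\right]$ and any fixed initial state of the chain, $\mathbb{E}[\tau_x^s]<\infty$ for all $x$ sufficiently large.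
   Context: $S$ is a finite non-empty set, and $\Sigma\subset[0,\infty)\times S$ is locally finite, meaning that $\Sigma\cap([0,c]\times S)$ is finite for every $c\ge 0$. For each $k\in S$ the line $\Lambda_k=\{x\ge 0:(x,k)\in\Sigma\}$ is unbounded. The chain is $(X_n,\eta_n)$, $n\in\{0,1,2,\dots\}$, with $X_n\in[0,\infty)$ and $\eta_n\in S$. Notation: for $(x,i)\in\Sigma$, $\mathbb{E}_{x,i}[\,\cdot\,]=\mathbb{E}[\,\cdot\mid X_n=x,\eta_n=i]$; $\mu_i(x)=\mathbb{E}_{x,i}[X_{n+1}-X_n]$; $\sigma_i^2(x)=\mathbb{E}_{x,i}[(X_{n+1}-X_n)^2]$; $q_{ij}(x)=\mathbb{P}[\eta_{n+1}=j\mid X_n=x,\eta_n=i]$. All asymptotics as $x\to\infty$ for quantities on line $i$ are along $x\in\Lambda_i$. For $x\ge 0$, $\tau_x=\min\{n\ge 0:X_n\le x\}$ (with $\min\emptyset=\infty$). $a\wedge b=\min(a,b)$. *)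

(* Defs.v *)
From HB Require Import structures.
From mathcomp Require Import all_boot all_order all_algebra.
From mathcomp Require Import all_classical all_reals all_analysis.

Set Implicit Arguments.
Unset Strict Implicit.
Unset Printing Implicit Defensive.

Import Order.TTheory GRing.Theory Num.Theory numFieldNormedType.Exports.

Local Open Scope classical_set_scope.
Local Open Scope ring_scope.

Definition half_strip (R : realType) (S : finType) (Sigma : set (R * S)) :=
  [/\ forall z, Sigma z -> 0 <= z.1,
      forall c : R, 0 <= c -> finite_set [set z | Sigma z /\ z.1 <= c] &
      forall (k : S) (c : R), exists2 x, Sigma (x, k) & c < x].

(* The filter "x tends to infinity along the line of i"; it is proper when the
   line is unbounded. *)
Definition line_infty (R : realType) (S : finType) (Sigma : set (R * S))
    (i : S) : set_system R :=
  within [set x | Sigma (x, i)] (pinfty_nbhs R).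

Global Instance line_infty_filter (R : realType) (S : finType)
    (Sigma : set (R * S)) (i : S) : Filter (line_infty Sigma i).
Proof. exact: within_filter. Qed.

Canonical line_infty_filter_on (R : realType) (S : finType)
    (Sigma : set (R * S)) (i : S) :=
  FilterType (line_infty Sigma i) (line_infty_filter Sigma i).

(* A time-homogeneous Markov chain on the countable set Sigma, given as one
   process Z with a family of laws: P z is the law of the chain started at z
   (P z is unconstrained for z outside Sigma).  As Sigma is countable,
   measurability of Z n amounts to that of the events [Z n = z].  By
   homogeneity, the conditional expectation given the state z at time n of a
   function of the state at time n.+1 is the expectation under P z of that
   function of Z 1. *)
Record markov_chain (R : realType) (S : finType) (Sigma : set (R * S))
    (d : measure_display) (Omega : measurableType d)
    (P : R * S -> probability Omega R) (Z : nat -> Omega -> R * S) : Prop := {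
  chain_state : forall n w, Sigma (Z n w) ;
  chain_meas : forall n z, measurable [set w | Z n w = z] ;
  chain_init : forall z, Sigma z -> P z [set w | Z 0%N w = z] = 1%E ;
  chain_markov : forall z (n : nat) (path : nat -> R * S), Sigma z ->
    P z [set w | forall k, (k <= n.+1)%N -> Z k w = path k] =
    (P z [set w | forall k, (k <= n)%N -> Z k w = path k] *
     P (path n) [set w | Z 1%N w = path n.+1])%E }.

Definition irreducible_chain (R : realType) (S : finType) (Sigma : set (R * S))
    (d : measure_display) (Omega : measurableType d)
    (P : R * S -> probability Omega R) (Z : nat -> Omega -> R * S) :=
  forall z z', Sigma z -> Sigma z' ->
    exists n : nat, (0 < P z [set w | Z n w = z'])%E.

Section increments.
Variables (R : realType) (S : finType) (d : measure_display)
  (Omega : measurableType d) (P : R * S -> probability Omega R)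
  (Z : nat -> Omega -> R * S).

Definition drift (i : S) (x : R) : R := \int[P (x, i)]_w ((Z 1%N w).1 - x).

Definition sq_incr (i : S) (x : R) : R :=
  \int[P (x, i)]_w ((Z 1%N w).1 - x) ^+ 2.

Definition line_prob (i j : S) (x : R) : R :=
  fine (P (x, i) [set w | (Z 1%N w).2 = j]).

(* inf set0 = +oo. *)
Definition passage_time (x : R) (w : Omega) : \bar R :=
  ereal_inf [set n%:R%:E | n in [set n : nat | (Z n w).1 <= x]].
End increments.

Section finite_chain.
Variables (R : realType) (S : finType).
Implicit Types (q : S -> S -> R) (pi : S -> R).

Definition stochastic q :=
  (forall i j, 0 <= q i j) /\ (forall i, \sum_j q i j = 1).

(* Entries of the n-th power of q. *)
Fixpoint iter_prob q (n : nat) (i j : S) : R :=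
  if n is n'.+1 then \sum_k q i k * iter_prob q n' k j else (i == j)%:R.

Definition irreducible_matrix q :=
  forall i j, exists n : nat, 0 < iter_prob q n i j.

Definition stationary q pi :=
  [/\ forall i, 0 <= pi i, \sum_i pi i = 1 &
      forall j, \sum_i pi i * q i j = pi j].
End finite_chain.

(* Main.v *)
Require Import Defs.
From mathcomp Require Import all_boot all_order all_algebra.
From mathcomp Require Import all_classical all_reals all_analysis.
From mathcomp Require Import measurable_realfun ring lra.
Import Order.TTheory GRing.Theory Num.Theory numFieldNormedType.Exports.
Local Open Scope classical_set_scope.
Local Open Scope ring_scope.

(** The Lyapunov function of the proof is [W^t] with [W (x, i) = x^2 + b_i]:
    the correction [b] averages out the dependence of the drift on the line.
    A second-order expansion, in which a jump of size comparable to [x]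
    contributes at most its [p]-th moment times [x^(2-p)]
    ([lyapunov_increment], [lyapunov_expectation]), gives
    [E (W_1^t) - W^t = t W^(t-1) (2 c_i + (2 t - 1) s_i^2
       + sum_j q_ij (b_j - b_i) + o(1))]
    provided that [2 t <= p].  As [q] is irreducible, [b] can be chosen such
    that the bracket tends on every line to the same number
    [sum_i (2 c_i + (2 t - 1) s_i^2) pi_i] ([poisson_equation]), which is
    negative for [t <= theta].  So far from the origin
    [E (W_1^t) <= W^t - e W^(t-1)] ([lyapunov_drift]).

    This drift condition bounds the moments of passage times through the
    time-dependent criterion [passage_time_moment]: if [G n (Z n)] decreases in
    mean by at least [(n+1)^s - n^s] before the passage, then summing up gives
    [E (tau^s) <= G 0].  Up to constant factors, for [1 <= s] one takes [t = s] and
    [G n = (W + a n)^s], a concave function of [W^s], so that the drift of [W^s]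
    controls it by Jensen's inequality ([passage_moment_ge1]).  For [s < 1]
    concavity is lost, but there is room to take [t] slightly larger than [s],
    even if [s = theta], as the condition is strict and [1 < p / 2]; then
    [G n = (1 + (n+1)^(s-t)) W^t] works ([passage_moment_lt1]).  The case
    [s = 0] is immediate.

    The only probabilistic input is the Markov property at a fixed time
    ([markov_property]), obtained from the path probabilities by summing over
    the countably many possible pasts. *)

Set Implicit Arguments.
Unset Strict Implicit.
Unset Printing Implicit Defensive.

(** * Poisson equation of a finite irreducible chain *)

Lemma iter_prob_ge0 (R : realType) (S : finType) (q : S -> S -> R) n i j :
  stochastic q -> 0 <= iter_prob q n i j.
Proof.
move=> [q0 _]; elim: n i => [i|n IH i] /=; first by rewrite ler0n.
by apply: sumr_ge0 => k _; rewrite mulr_ge0.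
Qed.

Lemma iter_prob_sum1 (R : realType) (S : finType) (q : S -> S -> R) n i :
  stochastic q -> \sum_j iter_prob q n i j = 1.
Proof.
move=> [_ q1]; elim: n i => [i|n IH i] /=.
  rewrite (bigD1 i)//= eqxx big1 ?addr0// => j /negbTE ji.
  by rewrite eq_sym ji.
rewrite exchange_big/= -[RHS](q1 i); apply: eq_bigr => k _.
by rewrite -mulr_sumr IH mulr1.
Qed.

Lemma iter_prob_harmonic (R : realType) (S : finType) (q : S -> S -> R)
    (h : S -> R) n i :
  (forall i, \sum_j q i j * h j = h i) -> \sum_j iter_prob q n i j * h j = h i.
Proof.
move=> qh; elim: n i => [i|n IH i] /=.
  rewrite (bigD1 i)//= eqxx mul1r big1 ?addr0// => j /negbTE ji.
  by rewrite eq_sym ji mul0r.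
under eq_bigr do rewrite mulr_suml.
rewrite exchange_big/= -[RHS]qh; apply: eq_bigr => k _.
by rewrite -[in RHS]IH mulr_sumr; apply: eq_bigr => j _; rewrite mulrA.
Qed.

(** The maximum principle: at a maximum [m] of [h] each iterate of [q] averages
    values at most [h m] to [h m], so [h] is maximal wherever some iterate
    charges, which by irreducibility is everywhere. *)
Lemma harmonic_const (R : realType) (S : finType) (q : S -> S -> R)
    (h : S -> R) :
  stochastic q -> irreducible_matrix q ->
  (forall i, \sum_j q i j * h j = h i) -> forall i j, h i = h j.
Proof.
move=> qs qi qh i0.
have [m _ hm] : exists2 m : S, true & forall j, h j <= h m.
  by case: (@arg_maxP _ R S i0 xpredT h erefl) => m _ H; exists m => // j; exact: H.
suff H j : h j = h m by move=> j; rewrite !H.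
have [n npos] := qi m j.
have H0 : \sum_k iter_prob q n m k * (h m - h k) = 0.
  under eq_bigr do rewrite mulrBr.
  by rewrite sumrB (iter_prob_harmonic n m qh) -mulr_suml iter_prob_sum1// mul1r subrr.
have : \sum_k iter_prob q n m k * (h m - h k) == 0.
  by rewrite H0.
rewrite psumr_eq0; last first.
  by move=> k _; rewrite mulr_ge0 ?iter_prob_ge0// subr_ge0.
move=> /allP/(_ j); rewrite mem_index_enum => /(_ isT)/=.
by rewrite mulf_eq0 gt_eqF//= subr_eq0 => /eqP ->.
Qed.

(** The Fredholm alternative for [q - 1].  The square system
    [(q b) i - b i - pi.b = - a i] has a trivial kernel: pairing a solution of
    the homogeneous system with [pi] gives [pi.b = 0], so [b] is harmonic,
    hence constant, hence zero.  It is therefore solvable, and pairing with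
    [pi] identifies [pi.b] with [pi.a].  Adding a constant to [b] makes it
    nonnegative. *)
Lemma poisson_equation (R : realType) (S : finType) (q : S -> S -> R)
    (pi : S -> R) (a : S -> R) :
  stochastic q -> irreducible_matrix q -> stationary q pi ->
  exists2 b : S -> R, (forall i, 0 <= b i) &
    forall i, a i + (\sum_j q i j * b j - b i) = \sum_j a j * pi j.
Proof.
move=> qs qi [pi0 pi1 piq].
pose e : S -> 'I_#|S| := enum_rank.
pose A : 'M[R]_#|S| := \matrix_(j, i)
  (q (enum_val i) (enum_val j) - (j == i)%:R - pi (enum_val j)).
have AE (v : 'rV[R]_#|S|) i : (v *m A) 0 (e i) =
    \sum_j q i j * v 0 (e j) - v 0 (e i) - \sum_j pi j * v 0 (e j).
  rewrite mxE (reindex e) /=; last first.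
    by exists enum_val => j _; rewrite /e ?enum_rankK ?enum_valK.
  under eq_bigr do rewrite !mxE !enum_rankK !mulrBr.
  rewrite !sumrB; congr (_ - _ - _).
  - by apply: eq_bigr => j _; rewrite mulrC.
  - rewrite (bigD1 i)//= eqxx mulr1 big1 ?addr0// => j ji.
    by rewrite (inj_eq enum_rank_inj) (negbTE ji) mulr0.
  - by apply: eq_bigr => j _; rewrite mulrC.
have piL (h : S -> R) : \sum_i pi i * (\sum_j q i j * h j - h i) = 0.
  under eq_bigr do rewrite mulrBr mulr_sumr.
  rewrite sumrB exchange_big/= (eq_bigr (fun j => pi j * h j)) ?subrr// => j _.
  by rewrite -[in RHS]piq mulr_suml; apply: eq_bigr => i _; rewrite mulrA.
have mean_of (h f : S -> R) k :
    (forall i, \sum_j q i j * h j - h i - k = f i) ->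
    k = - \sum_i pi i * f i.
  move=> H; have := piL h.
  rewrite (eq_bigr (fun i => pi i * f i + pi i * k)); last first.
    by move=> i _; rewrite -H; ring.
  by rewrite big_split/= -mulr_suml pi1 mul1r => /eqP; rewrite addrC addr_eq0 => /eqP.
have Aunit : A \in unitmx.
  rewrite unitmxE unitfE; apply/negP => /det0P[v v0 vA].
  have := v0; apply/negP; rewrite negbK.
  pose h j := v 0 (e j); pose k := \sum_j pi j * h j.
  have E i : \sum_j q i j * h j - h i - k = 0.
    by have := AE v i; rewrite vA mxE => <-.
  have k0 : k = 0.
    by rewrite (mean_of h (fun=> 0) k E) big1 ?oppr0// => i _; rewrite mulr0.
  have hc : forall i j, h i = h j.
    apply: (harmonic_const qs qi) => i; have := E i.
    by rewrite k0 subr0 => /eqP; rewrite subr_eq0 => /eqP.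
  have h0 j : h j = 0.
    rewrite -k0 /k (eq_bigr (fun i => pi i * h j)); last first.
      by move=> i _; rewrite (hc i j).
    by rewrite -mulr_suml pi1 mul1r.
  apply/eqP/rowP => i; rewrite mxE.
  by have := h0 (enum_val i); rewrite /h /e enum_valK.
pose v : 'rV[R]_#|S| := (\row_i (- a (enum_val i))) *m invmx A.
pose h j := v 0 (e j); pose k := \sum_j pi j * h j.
have E i : \sum_j q i j * h j - h i - k = - a i.
  by have := AE v i; rewrite mulmxKV// mxE enum_rankK => ->.
have kE : k = \sum_j a j * pi j.
  rewrite (mean_of h _ k E) -sumrN; apply: eq_bigr => i _; ring.
pose M := \sum_j `|h j|; exists (fun i => h i + M) => i.
  have : `|h i| <= M by rewrite /M (bigD1 i)//= lerDl sumr_ge0.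
  by rewrite ler_norml => /andP[]; rewrite -subr_ge0 opprK.
rewrite -kE; under eq_bigr do rewrite mulrDr.
rewrite big_split/= -mulr_suml qs.2 mul1r.
by have := E i; lra.
Qed.

(** * Real inequalities for powers *)

(** For [e <= 0], from [1 + y <= exp y] and [ln t <= t - 1]. *)
Lemma powR_tangent_le0 (R : realType) (e t : R) :
  e <= 0 -> 0 < t -> 1 + e * (t - 1) <= t `^ e.
Proof.
move=> e0 t0; rewrite /powR gt_eqF//.
apply: le_trans (expR_ge1Dx _); rewrite lerD2l.
have : ln t <= t - 1.
  have -> : t = 1 + (t - 1) by lra.
  by rewrite [X in _ <= X - 1]addrC addrK; apply: le_ln1Dx; lra.
by rewrite -subr_ge0 => H; rewrite -subr_ge0 -mulrBr mulr_le0// -opprB oppr_le0.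
Qed.

(** Bernoulli's inequality, from the case of exponent [1 - e] at [t^-1]. *)
Lemma powR_tangent_ge1 (R : realType) (e t : R) :
  1 <= e -> 0 <= t -> 1 + e * (t - 1) <= t `^ e.
Proof.
move=> e1; rewrite le_eqVlt => /predU1P[<-|t0].
  by apply: le_trans (powR_ge0 _ _); lra.
have e'0 : 1 - e <= 0 by lra.
have := powR_tangent_le0 e'0 (_ : 0 < t^-1); rewrite invr_gt0 => /(_ t0) H.
have tE : t `^ e = t * (t^-1) `^ (1 - e).
  rewrite -powR_inv1 ?ltW// -powRrM -{2}(powRr1 (ltW t0)) -powRD.
    by congr (_ `^ _); lra.
  by rewrite (gt_eqF t0) implybT.
rewrite tE; apply: le_trans (_ : t * (1 + (1 - e) * (t^-1 - 1)) <= _).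
  have -> : t * (1 + (1 - e) * (t^-1 - 1)) = t + (1 - e) * (t * t^-1 - t) by ring.
  by rewrite divff ?gt_eqF//; lra.
by rewrite ler_wpM2l// ltW.
Qed.

Lemma powRDn (R : realType) (x r s : R) : 0 < x -> x `^ (r + s) = x `^ r * x `^ s.
Proof. by move=> x0; rewrite powRD// (gt_eqF x0) implybT. Qed.

(** Applied twice, this gives the sign near [0] of a function that vanishes there
    to first order from the sign of its second derivative. *)
Lemma MVT_origin (R : realType) (f df : R -> R) (r0 x : R) : `|x| <= r0 ->
  (forall y : R, `|y| <= r0 -> is_derive y 1 f (df y)) ->
  exists c, [/\ `|c| <= r0, 0 <= c * x & f x - f 0 = df c * x].
Proof.
move=> xr Df.
have cf (a b : R) : - r0 <= a -> b <= r0 -> {within `[a, b], continuous f}.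
  move=> ra br; apply: derivable_within_continuous => y.
  rewrite in_itv/= => /andP[ay yb].
  by have [] := Df y _; rewrite // ler_norml (le_trans ra)// (le_trans yb).
move: (xr); rewrite ler_norml => /andP[rx xr'].
have r0_ge0 : 0 <= r0 by exact: le_trans (normr_ge0 x) xr.
have [x0|x0|->] := ltgtP x 0; last first.
- by exists 0; split; rewrite ?normr0 ?mulr0 ?subrr.
- have [y|c|c] := @MVT R f df 0 x x0.
  + rewrite in_itv/= => /andP[y0 yx]; apply: Df.
    by rewrite gtr0_norm// (le_trans (ltW yx)).
  + by apply: cf => //; rewrite oppr_le0.
  + rewrite in_itv/= => /andP[c0 cx] H; exists c; split.
    * by rewrite gtr0_norm// (le_trans (ltW cx)).
    * by rewrite mulr_ge0 ?ltW.
    * by rewrite H subr0.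
- have [y|c|c] := @MVT R f df x 0 x0.
  + rewrite in_itv/= => /andP[yx y0]; apply: Df.
    by rewrite ltr0_norm// lerNl (le_trans rx)// ltW.
  + by apply: cf.
  + rewrite in_itv/= => /andP[xc c0] H; exists c; split.
    * by rewrite ltr0_norm// lerNl (le_trans rx)// ltW.
    * by rewrite mulr_le0 ?ltW.
    * by rewrite -opprB H sub0r mulrN opprK.
Qed.

(** Second-order Taylor bound: since [(1 + r)^(s-2)] is continuous at [r = 0],
    the difference of the two sides is convex near [0], and it vanishes to
    first order there. *)
Lemma powR_taylor2 (R : realType) (s eta : R) : 0 < eta ->
  exists2 r0 : R, 0 < r0 < 1 & forall r : R, `|r| <= r0 ->
    (1 + r) `^ s <= 1 + s * r + (s * (s - 1) / 2 + eta) * r ^+ 2.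
Proof.
move=> eta0; pose A := s * (s - 1) / 2 + eta.
pose g r : R := 1 + s * r + A * r ^+ 2 - (1 + r) `^ s.
pose g1 r : R := s + A * (2 * r) - s * (1 + r) `^ (s - 1).
pose g2 r : R := A * 2 - s * ((s - 1) * (1 + r) `^ (s - 2)).
have DpowR (e y : R) : -1 < y ->
    is_derive y 1 (fun r : R => (1 + r) `^ e) (e * (1 + y) `^ (e - 1)).
  move=> y1.
  have y1' : 0 < 1 + y by lra.
  have H := is_derive1_powR e y1'.
  have H1 : is_derive y (1 : R) (fun r : R => 1 + r) (1 : R).
    have := is_deriveD (is_derive_cst (1 : R) y 1) (is_derive_id y (1 : R)).
    by rewrite add0r.
  by have := @is_derive1_comp R _ _ _ _ _ H H1; rewrite mulr1.
have Dg (y : R) : -1 < y -> is_derive y 1 g (g1 y).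
  move=> y1; have H := DpowR s y y1.
  have E := is_deriveB (is_deriveD (is_deriveD (is_derive_cst (1 : R) y 1)
    (is_deriveZ s (is_derive_id y (1 : R))))
    (is_deriveZ A (is_deriveX 2 (is_derive_id y (1 : R))))) H.
  apply: (is_derive_eq (E : is_derive y (1 : R) g _)).
  by rewrite /g1 /GRing.scale/= expr1; ring.
have Dg1 (y : R) : -1 < y -> is_derive y 1 g1 (g2 y).
  move=> y1; have H := DpowR (s - 1) y y1.
  have E := is_deriveB (is_deriveD (is_derive_cst s y (1 : R))
    (is_deriveZ A (is_deriveZ 2 (is_derive_id y (1 : R)))))
    (is_deriveZ s H).
  apply: (is_derive_eq (E : is_derive y (1 : R) g1 _)).
  rewrite /g2 /GRing.scale/=.
  have -> : s - 1 - 1 = s - 2 by ring.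
  by ring.
have g2c : {for 0, continuous g2}.
  have H := DpowR (s - 2) 0 (ltrN10 R).
  have [D _] := is_deriveB (is_derive_cst (A * 2) (0 : R) (1 : R))
    (is_deriveZ s (is_deriveZ (s - 1) H)).
  by apply: differentiable_continuous; apply/derivable1_diffP.
have g20 : 0 < g2 0 by rewrite /g2 addr0 powR1 /A; lra.
have [e /= e0 He] : nbhs (0 : R) [set y : R | 0 < g2 y].
  exact: (cvgr_gt (g2 0) g2c 0 g20).
exists (Num.min (e / 2) (1 / 2)); first by rewrite lt_min gt_min; lra.
move=> r rr0; have g2_ge0 (y : R) : `|y| <= Num.min (e / 2) (1 / 2) -> 0 <= g2 y.
  rewrite le_min => /andP[ye _]; apply/ltW/He => /=.
  by rewrite sub0r normrN; lra.
have gt_N1 (y : R) : `|y| <= Num.min (e / 2) (1 / 2) -> -1 < y.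
  rewrite le_min => /andP[_]; rewrite ler_norml; lra.
have [c [cr0 cr E]] := MVT_origin rr0 (fun y yr => Dg y (gt_N1 y yr)).
have [c' [c'r0 _ E']] := MVT_origin cr0 (fun y yr => Dg1 y (gt_N1 y yr)).
suff : 0 <= g r by rewrite /g subr_ge0.
have g0 : g 0 = 0 by rewrite /g addr0 powR1; ring.
have g10 : g1 0 = 0 by rewrite /g1 addr0 powR1; ring.
rewrite g0 subr0 in E; rewrite g10 subr0 in E'.
by rewrite E E' -mulrA mulr_ge0 ?g2_ge0.
Qed.

(** [u^(r-p)] is nonincreasing in [u]. *)
Lemma powR_le_lower_exponent (R : realType) (d u r p : R) :
  0 < d -> d <= u -> r <= p -> u `^ r <= d `^ (r - p) * u `^ p.
Proof.
move=> d0 du rp; have u0 : 0 < u by exact: lt_le_trans du.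
have -> : u `^ r = u `^ (r - p) * u `^ p by rewrite -powRDn// subrK.
rewrite ler_wpM2r ?powR_ge0//.
rewrite -(opprB p r) !powRN lef_pV2 ?posrE ?powR_gt0//.
by rewrite ge0_ler_powR ?nnegrE ?subr_ge0// ltW.
Qed.

(** To leading order the increment of [x^2 + b] caused by a jump [D] much smaller
    than [x] is [2 x D]; this turns the second-order term of a Taylor expansion
    in that increment into a multiple of [D^2]. *)
Lemma sq_increment_approx (R : realType) (d B x D b be : R) :
  0 <= d -> d <= 1 -> 1 <= x -> `|D| <= d * x -> 0 <= b <= B -> `|be| <= B ->
  `|(2 * x * D + D ^+ 2 + be) ^+ 2 - 4 * D ^+ 2 * (x ^+ 2 + b)| <=
  (1 + D ^+ 2) * (5 * d * x ^+ 2 + (8 * B + B ^+ 2) * x).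
Proof.
move=> d0 d1 x1 Dx /andP[b0 bB] beB.
have B0 : 0 <= B by lra.
have -> : (2 * x * D + D ^+ 2 + be) ^+ 2 - 4 * D ^+ 2 * (x ^+ 2 + b) =
  4 * (x * D ^+ 3) + D ^+ 4 + 2 * (be * D ^+ 2) + 4 * (be * x * D) + be ^+ 2
  - 4 * (b * D ^+ 2) by ring.
have DE : D ^+ 2 = `|D| ^+ 2 by rewrite real_normK ?num_real.
set a := `|D| in Dx DE; have a0 : 0 <= a by exact: normr_ge0.
have a2 : 0 <= a ^+ 2 by rewrite sqr_ge0.
have H1 : `|x * D ^+ 3| <= d * x ^+ 2 * a ^+ 2.
  rewrite normrM normrX -/a ger0_norm; last by lra.
  have : x * a ^+ 2 * a <= x * a ^+ 2 * (d * x).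
    by rewrite ler_wpM2l// mulr_ge0//; lra.
  lra.
have H2 : `|D ^+ 4| <= d * x ^+ 2 * a ^+ 2.
  rewrite normrX -/a; have : a ^+ 2 * a ^+ 2 <= a ^+ 2 * (d * x ^+ 2).
    rewrite ler_wpM2l//; apply: le_trans (_ : (d * x) ^+ 2 <= _).
      by rewrite lerXn2r// ?nnegrE ?mulr_ge0//; lra.
    rewrite exprMn ler_wpM2r ?sqr_ge0// expr2.
    by rewrite -[X in _ <= X]mulr1 ler_wpM2l.
  lra.
have H3 : `|be * D ^+ 2| <= B * a ^+ 2.
  by rewrite normrM normrX -/a ler_wpM2r.
have H4 : `|be * x * D| <= B * (x * a).
  rewrite !normrM -/a -mulrA (ger0_norm (_ : 0 <= x)); last by lra.
  by rewrite ler_wpM2r// mulr_ge0//; lra.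
have H4' : B * (2 * (x * a)) <= B * (x * (1 + a ^+ 2)).
  rewrite ler_wpM2l// mulrCA ler_wpM2l//; first lra.
  by have := sqr_ge0 (a - 1); lra.
have H5 : `|be ^+ 2| <= B ^+ 2.
  by rewrite normrX lerXn2r// nnegrE.
have H6 : `|b * D ^+ 2| <= B * a ^+ 2.
  by rewrite normrM normrX -/a ger0_norm// ler_wpM2r.
have H7 : B * a ^+ 2 <= B * (x * a ^+ 2).
  by rewrite ler_wpM2l// -[X in X <= _]mul1r ler_wpM2r.
have H8 : B ^+ 2 <= B ^+ 2 * (x * (1 + a ^+ 2)).
  by rewrite -[X in X <= _]mulr1 ler_wpM2l ?sqr_ge0// mulr_ege1//; lra.
have H9 : 0 <= d * x ^+ 2 by rewrite mulr_ge0 ?sqr_ge0.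
have H10 : 0 <= B * x by rewrite mulr_ge0//; lra.
move: H1 H2 H3 H4 H5 H6; rewrite !ler_norml DE.
set m1 := x * D ^+ 3; set m2 := D ^+ 4; set m3 := be * _; set m4 := be * _ * _.
set m5 := be ^+ 2; set m6 := b * _.
by move=> /andP[? ?] /andP[? ?] /andP[? ?] /andP[? ?] /andP[? ?] /andP[? ?];
  apply/andP; split; lra.
Qed.

(** Jumps [D] much smaller than [x]: the quadratic term of the Taylor bound at
    [T / w] is approximately [4 x^2 D^2 / w], that is [4 D^2]. *)
Lemma small_jump_increment (R : realType) (s e1 e2 r0 d B x b be D : R) :
  let w := x ^+ 2 + b in let T := 2 * x * D + D ^+ 2 + be in
  0 < s -> 0 < e1 -> 0 < e2 ->
  (forall r : R, `|r| <= r0 ->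
    (1 + r) `^ s <= 1 + s * r + (s * (s - 1) / 2 + s * e1) * r ^+ 2) ->
  0 < d -> d <= 1 -> d <= r0 / 6 -> d <= e2 / 10 -> 1 <= x ->
  0 <= b <= B -> `|be| <= B -> 2 * B <= r0 * x ->
  2 * (8 * B + B ^+ 2) <= e2 * x -> `|D| <= d * x ->
  w * (1 + T / w) `^ s <= w + s * (T + (2 * s - 2) * D ^+ 2
    + (e2 * `|s - 1| / 2 + e1 * (4 + e2)) * (1 + D ^+ 2)).
Proof.
move=> w T s0 e10 e20 taylor d0 d1 dr0 de2 x1 bB beB Br0x Be2x Dx.
have Q := sq_increment_approx (ltW d0) d1 x1 Dx bB beB.
move: bB => /andP[b0 bB].
have x_gt0 : 0 < x by exact: lt_le_trans x1.
have x2_gt0 : 0 < x ^+ 2 by rewrite exprn_gt0.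
have xx2 : x <= x ^+ 2 by rewrite expr2 ler_peMr// ltW.
have x2w : x ^+ 2 <= w by rewrite /w lerDl.
have w0 : 0 < w by exact: lt_le_trans x2w.
have r00 : 0 < r0 by move: dr0 d0; clear; lra.
have D20 : 0 <= D ^+ 2 by rewrite sqr_ge0.
have D21 : 0 <= 1 + D ^+ 2 by rewrite addr_ge0.
pose t := T / w; have tE : w * t = T by rewrite /t mulrC divfK// gt_eqF.
rewrite -/t.
have Tr : `|t| <= r0.
  rewrite /t normrM normfV (gtr0_norm w0) ler_pdivrMr//.
  have T1 : `|T| <= 2 * (x * `|D|) + `|D| ^+ 2 + B.
    rewrite /T (le_trans (ler_normD _ _))// lerD//.
    rewrite (le_trans (ler_normD _ _))// normrX lerD// !normrM.
    by rewrite (gtr0_norm x_gt0) (gtr0_norm (ltr0Sn _ _)) mulrA.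
  have T2 : x * `|D| <= d * x ^+ 2.
    have -> : d * x ^+ 2 = x * (d * x) by ring.
    by rewrite ler_pM2l.
  have T3 : `|D| ^+ 2 <= d * x ^+ 2.
    rewrite (le_trans (_ : _ <= (d * x) ^+ 2))//.
      by rewrite lerXn2r// nnegrE ?mulr_ge0// ltW.
    by rewrite exprMn ler_pM2r// expr2 ler_piMr// ltW.
  have T4 : d * x ^+ 2 <= r0 / 6 * x ^+ 2 by rewrite ler_pM2r.
  have T5 : r0 * x <= r0 * x ^+ 2 by rewrite ler_pM2l.
  have T6 : r0 * x ^+ 2 <= r0 * w by rewrite ler_pM2l.
  by move: T1 T2 T3 T4 T5 T6 Br0x; clear; lra.
pose q := w * t ^+ 2.
have q_approx : `|q - 4 * D ^+ 2| <= e2 * (1 + D ^+ 2).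
  rewrite -(ler_pM2l w0) -{1}(gtr0_norm w0) -normrM.
  have -> : w * (q - 4 * D ^+ 2) = T ^+ 2 - 4 * D ^+ 2 * w.
    by rewrite /q -tE; ring.
  apply: (le_trans Q).
  have -> : w * (e2 * (1 + D ^+ 2)) = (1 + D ^+ 2) * (e2 * w) by ring.
  rewrite ler_wpM2l//.
  have Q1 : d * x ^+ 2 <= e2 / 10 * x ^+ 2 by rewrite ler_pM2r.
  have Q2 : 2 * (8 * B + B ^+ 2) * x <= e2 * x * x by rewrite ler_pM2r.
  have Q3 : e2 * x ^+ 2 <= e2 * w by rewrite ler_pM2l.
  by move: Q1 Q2 Q3; clear; lra.
have H1 : w * (1 + t) `^ s <=
    w * (1 + s * t + (s * (s - 1) / 2 + s * e1) * t ^+ 2).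
  by rewrite ler_pM2l//; exact: taylor.
apply: (le_trans H1).
have -> : w * (1 + s * t + (s * (s - 1) / 2 + s * e1) * t ^+ 2) =
    w + s * (T + ((s - 1) / 2 + e1) * q) by rewrite /q -tE; ring.
rewrite lerD2l ler_pM2l// -!addrA lerD2l.
have H2 : (s - 1) * (q - 4 * D ^+ 2) <= `|s - 1| * (e2 * (1 + D ^+ 2)).
  by rewrite (le_trans (ler_norm _))// normrM ler_wpM2l.
have H3 : e1 * q <= e1 * ((4 + e2) * (1 + D ^+ 2)).
  rewrite ler_pM2l//; move: q_approx; rewrite ler_norml => /andP[_].
  by clear; lra.
by move: H2 H3; clear; lra.
Qed.

(** Jumps [D] of the order of [x] or more: with [u = |D| / x] bounded below by
    [d], each term is [x^2] times a power of [u] of exponent at most [p]. *)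
Lemma large_jump_increment (R : realType) (s p d : R) :
  0 < s -> 2 < p -> 2 * s <= p -> 0 < d ->
  exists2 K : R, 0 <= K & forall x D b b' : R,
    let w := x ^+ 2 + b in let T := 2 * x * D + D ^+ 2 + (b' - b) in
    0 < x -> 0 <= b <= x ^+ 2 -> 0 <= b' <= x ^+ 2 -> d * x <= `|D| ->
    w * (1 + T / w) `^ s <= w + s * (T + (2 * s - 2) * D ^+ 2
      + K * (x ^+ 2 * (`|D| / x) `^ p)).
Proof.
move=> s0 p2 sp d0; have dV0 : 0 < d^-1 by rewrite invr_gt0.
pose C1 := (d^-1 + 1) ^+ 2 + d^-1 ^+ 2.
pose C2 := 2 * d^-1 + `|2 * s - 1| + d^-1 ^+ 2.
have C10 : 0 <= C1 by rewrite /C1 addr_ge0 ?sqr_ge0.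
have C20 : 0 <= C2 by rewrite /C2 !addr_ge0 ?sqr_ge0// mulr_ge0 ?ltW.
pose K1 := 2 * (C1 `^ s * d `^ (2 * s - p)).
pose K2 := C2 * d `^ (2 - p).
have K10 : 0 <= K1 by rewrite /K1 !mulr_ge0 ?powR_ge0.
have K20 : 0 <= K2 by rewrite /K2 !mulr_ge0 ?powR_ge0.
exists (K1 / s + K2); first by rewrite addr_ge0// divr_ge0// ltW.
move=> x D b b' w T x_gt0 /andP[b0 bx] /andP[b'0 b'x] Dx.
have x2_gt0 : 0 < x ^+ 2 by rewrite exprn_gt0.
have x2w : x ^+ 2 <= w by rewrite /w lerDl.
have w2x : w <= 2 * x ^+ 2 by rewrite /w mulr2n mulrDl mul1r lerD2l.
have w0 : 0 < w by exact: lt_le_trans x2w.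
have wTE : w + T = (x + D) ^+ 2 + b' by rewrite /w /T; ring.
pose t := T / w; have tE : w * t = T by rewrite /t mulrC divfK// gt_eqF.
have t10 : 0 <= 1 + t.
  by rewrite -(pmulr_rge0 _ w0) mulrDr mulr1 tE wTE addr_ge0 ?sqr_ge0.
rewrite -/t; set L := x ^+ 2 * _.
have [u uE] : {u | u = `|D| / x} by eexists.
have ux : `|D| = u * x by rewrite uE divfK// gt_eqF.
have du : d <= u by rewrite uE ler_pdivlMr.
have u0 : 0 < u by exact: lt_le_trans du.
have LE : L = x ^+ 2 * u `^ p by rewrite uE.
have u1 : 1 <= d^-1 * u by rewrite mulrC ler_pdivlMr// mul1r.
have u2 : u <= d^-1 * u ^+ 2.
  by rewrite expr2 mulrA -[X in X <= _]mul1r ler_pM2r.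
have u3 : 1 <= d^-1 ^+ 2 * u ^+ 2 by rewrite -exprMn exprn_ege1.
have u20 : 0 <= u ^+ 2 by rewrite sqr_ge0.
have D2E : D ^+ 2 = u ^+ 2 * x ^+ 2.
  by rewrite -exprMn -ux real_normK ?num_real.
have C1u : 1 + t <= C1 * u ^+ 2.
  rewrite -(ler_pM2l w0 (1 + t)) [X in X <= _]mulrDr tE mulr1 wTE.
  apply: (le_trans (_ : _ <= x ^+ 2 * (C1 * u ^+ 2))); last first.
    by rewrite (ler_wpM2r (mulr_ge0 C10 u20)).
  have Z1 : (x + D) ^+ 2 <= (x * (1 + u)) ^+ 2.
    rewrite -[(x + D) ^+ 2]real_normK ?num_real//.
    apply: lerXn2r; rewrite ?nnegrE ?mulr_ge0 ?addr_ge0 ?(ltW x_gt0) ?(ltW u0)//.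
    by rewrite (le_trans (ler_normD _ _))// (gtr0_norm x_gt0) ux mulrDr mulr1 mulrC.
  have Z2 : x ^+ 2 * (1 + u) ^+ 2 <= x ^+ 2 * (d^-1 * u + u) ^+ 2.
    rewrite ler_pM2l//; apply: lerXn2r; last by rewrite lerD2r.
    - by rewrite nnegrE addr_ge0// ltW.
    - by rewrite nnegrE addr_ge0 ?mulr_ge0// ltW.
  have Z3 : x ^+ 2 * 1 <= x ^+ 2 * (d^-1 ^+ 2 * u ^+ 2) by rewrite ler_pM2l.
  by rewrite exprMn in Z1; move: Z1 Z2 Z3 b'x; rewrite /C1; clear; lra.
have G1 : w * (1 + t) `^ s <= K1 * L.
  have -> : K1 * L = (2 * x ^+ 2) * (C1 `^ s * (d `^ (2 * s - p) * u `^ p)).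
    by rewrite /K1 LE; ring.
  apply: ler_pM => //; [exact: ltW|exact: powR_ge0|].
  apply: (le_trans (_ : _ <= (C1 * u ^+ 2) `^ s)).
    by apply: (ge0_ler_powR (ltW s0)); rewrite // nnegrE// mulr_ge0.
  rewrite powRM// ler_wpM2l ?powR_ge0//.
  rewrite -(powR_mulrn 2 (ltW u0)) -powRrM.
  by apply: powR_le_lower_exponent.
have G2 : - (T + (2 * s - 2) * D ^+ 2) <= K2 * L.
  have -> : K2 * L = C2 * (x ^+ 2 * (d `^ (2 - p) * u `^ p)).
    by rewrite /K2 LE; ring.
  apply: (le_trans (_ : _ <= C2 * (x ^+ 2 * u ^+ 2))); last first.
    rewrite ler_wpM2l// ler_pM2l//.
    have := powR_le_lower_exponent d0 du (ltW p2).
    by rewrite -(powR_mulrn 2 (ltW u0)).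
  have -> : T + (2 * s - 2) * D ^+ 2 =
      2 * x * D + (2 * s - 1) * D ^+ 2 + (b' - b) by rewrite /T; ring.
  have Z1 : - (x * D) <= x ^+ 2 * u.
    have -> : x ^+ 2 * u = x * (u * x) by ring.
    by rewrite -mulrN ler_pM2l// -ux -normrN ler_norm.
  have Z2 : x ^+ 2 * u <= x ^+ 2 * (d^-1 * u ^+ 2) by rewrite ler_pM2l.
  have Z3 : x ^+ 2 * 1 <= x ^+ 2 * (d^-1 ^+ 2 * u ^+ 2) by rewrite ler_pM2l.
  have Z4 : - (2 * s - 1) * D ^+ 2 <= `|2 * s - 1| * D ^+ 2.
    by rewrite ler_wpM2r ?sqr_ge0// -normrN ler_norm.
  rewrite D2E in Z4 *; move: Z1 Z2 Z3 Z4 bx b'0; rewrite /C2.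
  by clear; lra.
have G3 : s * - (T + (2 * s - 2) * D ^+ 2) <= s * (K2 * L) by rewrite ler_pM2l.
have -> : s * (T + (2 * s - 2) * D ^+ 2 + (K1 / s + K2) * L) =
     s * (T + (2 * s - 2) * D ^+ 2) + K1 * L + s * (K2 * L).
  by rewrite -[K1 in RHS](divfK (_ : s != 0)) ?gt_eqF//; ring.
by move: G1 G3 w0; clear; lra.
Qed.

(** The increment of [(X^2 + b)^s] over a jump [D] from [(x, i)], in a form
    whose expectation only involves the first two moments and the [p]-th
    absolute moment of [D]. *)
Lemma lyapunov_increment (R : realType) (s p B eta : R) :
  0 < s -> 2 < p -> 2 * s <= p -> 0 <= B -> 0 < eta ->
  exists K x0 : R, [/\ 0 <= K, 1 <= x0 &
    forall x D b b', x0 <= x -> 0 <= b <= B -> 0 <= b' <= B ->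
    ((x + D) ^+ 2 + b') `^ s <= (x ^+ 2 + b) `^ s +
      s * (x ^+ 2 + b) `^ (s - 1) * (2 * x * D + (2 * s - 1) * D ^+ 2
        + (b' - b) + eta * (1 + D ^+ 2) + K * (x ^+ 2 * (`|D| / x) `^ p))].
Proof.
move=> s0 p2 sp B0 eta0.
pose e2 := eta / (`|s - 1| + 1).
have s10 : 0 < `|s - 1| + 1 by rewrite ltr_wpDl.
have e20 : 0 < e2 by rewrite /e2 divr_gt0.
have e2E : e2 * (`|s - 1| + 1) = eta by rewrite /e2 divfK// gt_eqF.
pose e1 := eta / (2 * (4 + e2)).
have e240 : 0 < 2 * (4 + e2) by rewrite mulr_gt0 ?addr_gt0.
have e10 : 0 < e1 by rewrite /e1 divr_gt0.
have e1E : e1 * (2 * (4 + e2)) = eta by rewrite /e1 divfK// gt_eqF.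
have [r0 /andP[r00 r01] taylor] := powR_taylor2 s (mulr_gt0 s0 e10).
(* The threshold between small and large jumps. *)
pose d := Num.min (r0 / 6) (Num.min (e2 / 10) 1).
have d0 : 0 < d by rewrite /d !lt_min !divr_gt0/=.
have dr0 : d <= r0 / 6 by rewrite /d ge_min lexx.
have de2 : d <= e2 / 10 by rewrite /d !ge_min lexx orbT.
have d1 : d <= 1 by rewrite /d !ge_min lexx !orbT.
have [K K0 large] := large_jump_increment s0 p2 sp d0.
(* From x0 on, b and b' are negligible with respect to x. *)
pose x0 := 1 + B + 2 * B / r0 + 2 * (8 * B + B ^+ 2) / e2.
have Br0 : 0 <= 2 * B / r0 by rewrite divr_ge0 ?mulr_ge0// ltW.
have Be2 : 0 <= 2 * (8 * B + B ^+ 2) / e2.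
  by rewrite divr_ge0 ?mulr_ge0 ?addr_ge0 ?mulr_ge0 ?sqr_ge0// ltW.
exists K, x0; split => [//||x D b b' x0x bB bB'].
  by rewrite /x0 -!addrA lerDl !addr_ge0.
have {x0x} [x1 [Bx [Br0x Be2x]]] : 1 <= x /\ B <= x /\ 2 * B / r0 <= x /\
    2 * (8 * B + B ^+ 2) / e2 <= x.
  move: x0x Br0 Be2 B0; rewrite /x0; clear.
  by move=> *; do !split; lra.
rewrite ler_pdivrMr// [X in _ <= X]mulrC in Br0x.
rewrite ler_pdivrMr// [X in _ <= X]mulrC in Be2x.
have x_gt0 : 0 < x by exact: lt_le_trans x1.
have xx2 : x <= x ^+ 2 by rewrite expr2 ler_peMr// ltW.
have x2_gt0 : 0 < x ^+ 2 by rewrite exprn_gt0.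
have Bx2 : B <= x ^+ 2 by exact: le_trans xx2.
move: (bB) (bB') => /andP[b0 bB1] /andP[b'0 bB1'].
set w := x ^+ 2 + b; have w0 : 0 < w by rewrite /w ltr_wpDr.
pose T := 2 * x * D + D ^+ 2 + (b' - b).
have wTE : (x + D) ^+ 2 + b' = w + T by rewrite /w /T; ring.
have wT0 : 0 <= w + T by rewrite -wTE addr_ge0 ?sqr_ge0.
have wtE : w + T = w * (1 + T / w) by field; rewrite gt_eqF.
have t10 : 0 <= 1 + T / w by rewrite -(pmulr_rge0 _ w0) -wtE.
set y := w `^ (s - 1); have y0 : 0 < y by rewrite powR_gt0.
have wsE : w `^ s = w * y by rewrite /y mulr_powRB1// ltW.
rewrite wTE wtE (powRM _ (ltW w0) t10) wsE.
set L := x ^+ 2 * _; have L0 : 0 <= L by rewrite /L mulr_ge0 ?powR_ge0// ltW.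
have D20 : 0 <= D ^+ 2 by rewrite sqr_ge0.
suff : w * (1 + T / w) `^ s <= w + s * (T + (2 * s - 2) * D ^+ 2
    + eta * (1 + D ^+ 2) + K * L).
  rewrite -(ler_pM2l y0) => H.
  rewrite mulrAC mulrC; apply: (le_trans H).
  by rewrite le_eqVlt; apply/orP; left; apply/eqP; rewrite /T; ring.
have [Dx|Dx] := leP `|D| (d * x).
  have beB : `|b' - b| <= B.
    by rewrite ler_norml; move: b0 bB1 b'0 bB1'; clear; lra.
  have H0 := small_jump_increment s0 e10 e20 taylor d0 d1 dr0 de2 x1
    bB beB Br0x Be2x Dx.
  apply: (le_trans H0).
  rewrite lerD2l ler_pM2l// -!addrA lerD2l// lerD2l.
  have H1 : e1 * (2 * (4 + e2)) * (1 + D ^+ 2) = eta * (1 + D ^+ 2).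
    by rewrite e1E.
  have H2 : e2 * (`|s - 1| + 1) * (1 + D ^+ 2) = eta * (1 + D ^+ 2).
    by rewrite e2E.
  have H3 : 0 <= e2 * (1 + D ^+ 2) by rewrite mulr_ge0 ?addr_ge0// ltW.
  have H4 : 0 <= K * L by rewrite mulr_ge0.
  by move: H1 H2 H3 H4; clear; lra.
apply: (le_trans (large x D b b' x_gt0 _ _ (ltW Dx))).
- by rewrite b0/= (le_trans bB1).
- by rewrite b'0/= (le_trans bB1').
- by rewrite lerD2l ler_pM2l// lerD2r lerDl mulr_ge0 ?addr_ge0// ltW.
Qed.

(** * Markov property at a fixed time *)

Lemma measurable_discrete_preimage d (Omega : measurableType d) (T : countType)
    (f : Omega -> T) (A : set T) :
  (forall t, measurable (f @^-1` [set t])) -> measurable (f @^-1` A).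
Proof.
move=> mf.
have -> : f @^-1` A = \bigcup_(t : T) (f @^-1` [set t] `&` [set _ | A t]).
  apply/seteqP; split => [w /= Aw|w [t _ [/= <-]//]].
  by exists (f w).
apply: countable_bigcupT_measurable => [|t]; first exact: countableP.
have [At|At] := pselect (A t).
  by rewrite (_ : [set _ | _] = setT) ?setIT//; apply/seteqP; split.
by rewrite (_ : [set _ | _] = set0) ?setI0//; apply/seteqP; split.
Qed.

Lemma integral_fibers d (Omega : measurableType d) (R : realType)
    (mu : {measure set Omega -> \bar R}) (T : countType) (f : Omega -> T)
    (D : set Omega) (F : Omega -> \bar R) :
  measurable D -> (forall t, measurable (f @^-1` [set t])) ->
  measurable_fun D F -> (forall w, D w -> 0 <= F w)%E ->
  (\int[mu]_(w in D) F w = \sum_(0 <= n <oo)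
    (if pickle_inv n is Some t then \int[mu]_(w in D `&` f @^-1` [set t]) F w
     else 0))%E.
Proof.
move=> mD mf mF F0.
pose E n := D `&` (fun w => pickle (f w)) @^-1` [set n].
have ED : D = \bigcup_n E n.
  by apply/seteqP; split => [w Dw|w [n _ []//]]; exists (pickle (f w)).
have mE n : measurable (E n).
  by apply: measurableI => //; exact: (measurable_discrete_preimage [set t | pickle t = n] mf).
rewrite [in LHS]ED ge0_integral_bigcup//; last 3 first.
- by rewrite -ED.
- by rewrite -ED.
- by apply/trivIsetP => i j _ _ /eqP ij; apply/seteqP; split => // w [[_ /= Ei] [_ /= Ej]];
    apply: ij; rewrite -Ei -Ej.
apply: eq_eseriesr => n _.
case E' : (pickle_inv n) => [t|].
  congr (integral _ _ _); rewrite /E; congr (_ `&` _).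
  apply/seteqP; split => w /=.
    move=> H; have : pickle_inv n = Some (f w) by rewrite -H pickleK_inv.
    by rewrite E' => -[].
  by move=> ->; have := @pickle_invK T n; rewrite E'.
rewrite (_ : E n = set0) ?integral_set0//; apply/seteqP; split => // w [_ /= H].
have : pickle_inv n = Some (f w) by rewrite -H pickleK_inv.
by rewrite E'.
Qed.

(** This plays the role of conditioning on a discrete variable: an identity of
    integrals, possibly over two different spaces, only has to be checked where
    the variable is constant. *)
Lemma eq_integral_fibers d1 d2 (Omega1 : measurableType d1)
    (Omega2 : measurableType d2) (R : realType)
    (mu1 : {measure set Omega1 -> \bar R}) (mu2 : {measure set Omega2 -> \bar R})
    (T : countType) (f1 : Omega1 -> T) (f2 : Omega2 -> T)
    (D1 : set Omega1) (D2 : set Omega2)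
    (F1 : Omega1 -> \bar R) (F2 : Omega2 -> \bar R) :
  measurable D1 -> (forall t, measurable (f1 @^-1` [set t])) ->
  measurable_fun D1 F1 -> (forall w, D1 w -> 0 <= F1 w)%E ->
  measurable D2 -> (forall t, measurable (f2 @^-1` [set t])) ->
  measurable_fun D2 F2 -> (forall w, D2 w -> 0 <= F2 w)%E ->
  (forall t, \int[mu1]_(w in D1 `&` f1 @^-1` [set t]) F1 w =
             \int[mu2]_(w in D2 `&` f2 @^-1` [set t]) F2 w)%E ->
  (\int[mu1]_(w in D1) F1 w = \int[mu2]_(w in D2) F2 w)%E.
Proof.
move=> mD1 mf1 mF1 F10 mD2 mf2 mF2 F20 H.
rewrite (integral_fibers mu1 mD1 mf1 mF1 F10).
rewrite (integral_fibers mu2 mD2 mf2 mF2 F20).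
by apply: eq_eseriesr => n _; case: pickle_inv.
Qed.

(** The half strip is a countable union of finite sets. *)
Lemma half_strip_code (R : realType) (S : finType) (Sigma : set (R * S)) :
  half_strip Sigma -> exists code : R * S -> nat,
    forall z z', Sigma z -> Sigma z' -> code z = code z' -> z = z'.
Proof.
move=> [Sigma0 fin _].
have : countable Sigma.
  rewrite (_ : Sigma = \bigcup_(n : nat) [set z | Sigma z /\ z.1 <= n%:R]).
    apply: bigcup_countable => // n _; exact: finite_set_countable (fin _ _).
  apply/seteqP; split => [z Sz|z [n _ []//]].
  exists (Num.truncn z.1).+1 => //=; split=> //.
  by rewrite ltW// truncnS_gt.
move=> /countable_injP[code inj]; exists code => z z' Sz Sz'.
by apply: inj; rewrite inE.
Qed.

(** Membership in the sigma-algebra of the states up to time [n], which is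
    discrete as the states are. *)
Definition past_event (R : realType) (S : finType) (Omega : Type)
    (Z : nat -> Omega -> R * S) (n : nat) (E : set Omega) :=
  forall w w', (forall k, (k <= n)%N -> Z k w = Z k w') -> E w -> E w'.

Lemma measurable_path (R : realType) (S : finType) (Sigma : set (R * S))
  (d : measure_display) (Omega : measurableType d)
  (P : R * S -> probability Omega R) (Z : nat -> Omega -> R * S) n
  (path : nat -> R * S) :
  markov_chain Sigma P Z ->
  measurable [set w | forall k, (k <= n)%N -> Z k w = path k].
Proof.
move=> Zm.
rewrite (_ : mkset _ = \bigcap_(k in `I_n.+1) [set w | Z k w = path k]).
  by apply: fin_bigcap_measurable => // k _; exact: chain_meas Zm _ _.
by apply/seteqP; split => w H k kn; exact: H.
Qed.

(** A countable type for the past makes [eq_integral_fibers] applicable to it;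
    the type of the states itself is uncountable. *)
Lemma past_code (R : realType) (S : finType) (Sigma : set (R * S))
  (d : measure_display) (Omega : measurableType d)
  (P : R * S -> probability Omega R) (Z : nat -> Omega -> R * S) (n : nat) :
  half_strip Sigma -> markov_chain Sigma P Z ->
  exists f : Omega -> seq nat,
    [/\ forall w w', f w = f w' <-> (forall k, (k <= n)%N -> Z k w = Z k w') &
        forall t, measurable (f @^-1` [set t])].
Proof.
move=> strip Zm; have [code inj] := half_strip_code strip.
pose f w := [seq code (Z k w) | k <- iota 0 n.+1].
have fE w w' : f w = f w' <-> (forall k, (k <= n)%N -> Z k w = Z k w').
  split=> [/eq_in_map H k kn|H].
    apply: inj; [exact: chain_state Zm _ _|exact: chain_state Zm _ _|].
    by apply: H; rewrite mem_iota.
  by apply/eq_in_map => k; rewrite mem_iota add0n ltnS => /andP[_ kn]; rewrite H.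
exists f; split=> // t.
have [[w0 <-]|no] := pselect (exists w, f w = t).
  rewrite (_ : _ @^-1` _ = [set w | forall k, (k <= n)%N -> Z k w = Z k w0]).
    exact: measurable_path Zm.
  by apply/seteqP; split => w /= /fE.
rewrite (_ : _ @^-1` _ = set0)//; apply/seteqP; split => // w /= fw.
by apply: no; exists w.
Qed.

Lemma measurable_past_event (R : realType) (S : finType) (Sigma : set (R * S))
  (d : measure_display) (Omega : measurableType d)
  (P : R * S -> probability Omega R) (Z : nat -> Omega -> R * S) (n : nat)
  (E : set Omega) :
  half_strip Sigma -> markov_chain Sigma P Z ->
  past_event Z n E -> measurable E.
Proof.
move=> strip Zm En; have [f [fE mf]] := past_code n strip Zm.
rewrite (_ : E = f @^-1` (f @` E)); first exact: measurable_discrete_preimage.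
apply/seteqP; split => [w Ew|w [w' Ew' /fE H]]; first by exists w.
exact: En Ew'.
Qed.

Lemma measurable_fun_state (R : realType) (S : finType) (Sigma : set (R * S))
  (d d' : measure_display) (Omega : measurableType d) (V : measurableType d')
  (P : R * S -> probability Omega R) (Z : nat -> Omega -> R * S) (n : nat)
  (D : set Omega) (g : R * S -> V) :
  half_strip Sigma -> markov_chain Sigma P Z ->
  measurable_fun D (fun w => g (Z n w)).
Proof.
move=> strip Zm; apply: (@measurable_funS _ _ _ _ setT) => // _ Y mY.
apply: measurableI => //; apply: (@measurable_past_event _ _ _ _ _ _ _ n _ strip Zm).
by move=> w w' H; rewrite /preimage/= H.
Qed.

(** Both sides are compared on each past, where the right one is constant; there
    the left one is computed over the fibers of [Z n.+1], whose probabilities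
    are given by [chain_markov]. *)
Lemma markov_property (R : realType) (S : finType) (Sigma : set (R * S))
  (d : measure_display) (Omega : measurableType d)
  (P : R * S -> probability Omega R) (Z : nat -> Omega -> R * S) (n : nat)
  (z : R * S) (E : set Omega) (F : R * S -> \bar R) :
  half_strip Sigma -> markov_chain Sigma P Z -> Sigma z ->
  past_event Z n E -> (forall y, 0 <= F y)%E ->
  (\int[P z]_(w in E) F (Z n.+1 w) =
   \int[P z]_(w in E) \int[P (Z n w)]_w' F (Z 1%N w'))%E.
Proof.
move=> strip Zm Sz En F0.
have [f [fE mf]] := past_code n strip Zm.
have [code inj] := half_strip_code strip.
have mE := measurable_past_event strip Zm En.
have mcode k t : measurable ((fun w => code (Z k w)) @^-1` [set t]).
  apply: (@measurable_past_event _ _ _ _ _ _ _ k _ strip Zm).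
  by move=> w w' H; rewrite /preimage/= H.
pose g y := (\int[P y]_w' F (Z 1%N w'))%E.
have g0 y : (0 <= g y)%E by apply: integral_ge0.
apply: (eq_integral_fibers mE mf _ _ mE mf) => //.
- exact: measurable_fun_state strip Zm.
- exact: (measurable_fun_state n g strip Zm).
- by move=> w _; exact: g0.
move=> t.
have [[w0 Ew0 fw0]|no] := pselect (exists2 w, E w & f w = t); last first.
  rewrite (_ : _ `&` _ = set0) ?integral_set0//.
  by apply/seteqP; split => // w [Ew fw]; apply: no; exists w.
set A := E `&` _.
have AE : A = [set w | forall k, (k <= n)%N -> Z k w = Z k w0].
  apply/seteqP; split => [w [_ /=]|w H]; first by rewrite -fw0 => /fE.
  split; last by rewrite /= -fw0; apply/fE.
  by apply: En Ew0 => k kn; rewrite H.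
have mA : measurable A by rewrite AE; exact: measurable_path Zm.
rewrite [RHS](eq_integral (cst (g (Z n w0)))); last first.
  by move=> w; rewrite AE inE /= => /(_ n (leqnn n)) ->.
have -> : (\int[P z]_(w in A) cst (g (Z n w0)) w =
    \int[P (Z n w0)]_w (P z A * F (Z 1%N w)))%E.
  rewrite [LHS]integral_cst// [RHS]ge0_integralZl//; last first.
    exact: measurable_fun_state strip Zm.
  by rewrite muleC.
apply: (eq_integral_fibers mA (mcode n.+1) _ _ measurableT (mcode 1%N)) => //.
- exact: measurable_fun_state strip Zm.
- by apply: measurable_funeM; exact: measurable_fun_state strip Zm.
- by move=> w _; rewrite mule_ge0.
move=> u; have [[y Sy yu]|no] := pselect (exists2 y, Sigma y & code y = u); last first.
  have fiber0 k D : D `&` (fun w => code (Z k w)) @^-1` [set u] = set0.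
    apply/seteqP; split => // w [_ /= H]; apply: no.
    by exists (Z k w) => //; exact: chain_state Zm _ _.
  by rewrite !fiber0 !integral_set0.
have fiberE k : (fun w => code (Z k w)) @^-1` [set u] = [set w | Z k w = y].
  apply/seteqP; split => w /=; last by move=> ->.
  by rewrite -yu; apply: inj => //; exact: chain_state Zm _ _.
rewrite !fiberE setTI.
have mZ k := chain_meas Zm k y.
rewrite (eq_integral (cst (F y))); last by move=> w; rewrite inE => -[_ /= ->].
rewrite [RHS](eq_integral (cst (P z A * F y)%E)); last by move=> w; rewrite inE /= => ->.
rewrite !integral_cst//; last exact: measurableI.
rewrite [in RHS]muleAC [in RHS]muleC; congr (_ * _)%E.
pose path k := if (k <= n)%N then Z k w0 else y.
have := chain_markov Zm n path Sz.
rewrite {3 4}/path leqnn ltnn AE.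
rewrite (_ : [set w | forall k, (k <= n)%N -> Z k w = path k] =
  [set w | forall k, (k <= n)%N -> Z k w = Z k w0]); last first.
  apply/seteqP; split => w H k kn; have := H k kn; rewrite /path kn//.
move=> <-; congr (P z _); apply/seteqP; split => w /=.
  move=> [H Hy] k; rewrite leq_eqVlt => /predU1P[->|]; first by rewrite /path ltnn.
  by rewrite ltnS => kn; rewrite /path kn H.
move=> H; split=> [k kn|]; last by rewrite H// /path ltnn.
by rewrite H ?leqW// /path kn.
Qed.

(** * Foster-Lyapunov criterion for moments of passage times *)

Definition above (R : realType) (S : finType) (Omega : Type)
    (Z : nat -> Omega -> R * S) (x : R) (n : nat) : set Omega :=
  [set w | forall k, (k < n)%N -> x < (Z k w).1].

Lemma passage_time_finite (R : realType) (S : finType)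
    (d : measure_display) (Omega : measurableType d)
    (Z : nat -> Omega -> R * S) (x : R) (m : nat) (w : Omega) :
  above Z x m w -> (Z m w).1 <= x -> passage_time Z x w = m%:R%:E.
Proof.
move=> wm Zx; apply/eqP; rewrite eq_le; apply/andP; split.
  by apply: ereal_inf_lbound; exists m.
apply: le_ereal_inf_tmp => _ [n /= Znx <-].
rewrite lee_fin ler_nat leqNgt; apply/negP => nm.
by have := wm n nm; rewrite ltNge Znx.
Qed.

Lemma passage_time_infinite (R : realType) (S : finType)
    (d : measure_display) (Omega : measurableType d)
    (Z : nat -> Omega -> R * S) (x : R) (w : Omega) :
  (forall n, x < (Z n w).1) -> passage_time Z x w = +oo%E.
Proof.
move=> H; rewrite /passage_time (_ : [set _ | _ in _] = set0) ?ereal_inf0//.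
by apply/seteqP; split => // _ [n /= + _]; rewrite leNgt H.
Qed.

Definition powR_step (R : realType) (s : R) (n : nat) : R :=
  n.+1%:R `^ s - n%:R `^ s.

Lemma powR_step_ge0 (R : realType) (s : R) n : 0 <= s -> 0 <= powR_step s n.
Proof. by move=> s0; rewrite subr_ge0 ge0_ler_powR ?nnegrE ?ler_nat. Qed.

Lemma sum_powR_step (R : realType) (s : R) n :
  0 < s -> \sum_(0 <= k < n) powR_step s k = n%:R `^ s.
Proof.
move=> s0; rewrite telescope_sumr// powR0 ?subr0//.
by rewrite gt_eqF.
Qed.

(** Summation by parts, valid also when the passage never happens because
    [n^s] is unbounded. *)
Lemma passage_time_powR (R : realType) (S : finType)
    (d : measure_display) (Omega : measurableType d)
    (Z : nat -> Omega -> R * S) (x s : R) (w : Omega) : 0 < s ->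
  (passage_time Z x w `^ s =
   \sum_(0 <= n <oo) ((powR_step s n)%:E * (\1_(above Z x n.+1) w)%:E))%E.
Proof.
move=> s0; set u := fun n => ((powR_step s n)%:E * (\1_(above Z x n.+1) w)%:E)%E.
have u0 n : (0 <= u n)%E.
  by rewrite /u mule_ge0// lee_fin ?powR_step_ge0 ?ltW.
have partial N : above Z x N w -> (\sum_(0 <= n < N) u n = (N%:R `^ s)%:E)%E.
  move=> wN; rewrite -sum_powR_step// -sumEFin.
  rewrite !big_nat; apply: eq_bigr => n nN; rewrite /u indicE mem_set ?mule1//.
  by move=> k kn; apply: wN; exact: leq_trans nN.
have [H|/existsNP[m' /negP]] := pselect (forall n, x < (Z n w).1).
  rewrite passage_time_infinite// poweRyr ?gt_eqF//.
  apply/esym/eqyP => M M0; pose N := (Num.truncn (M `^ s^-1)).+1.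
  have wN : above Z x N w by move=> k _.
  apply: (@le_trans _ _ (N%:R `^ s)%:E); last first.
    by rewrite -(partial N wN); apply: nneseries_lim_ge.
  have {1}-> : M = (M `^ s^-1) `^ s by rewrite -powRrM mulVf ?powRr1 ?gt_eqF// ltW.
  by rewrite lee_fin ge0_ler_powR ?nnegrE ?powR_ge0 ?ltW// truncnS_gt.
rewrite -leNgt => Zm'; have [m Zm min_m] := @ex_minnP (fun n => (Z n w).1 <= x) (ex_intro _ m' Zm').
have wm : above Z x m w.
  by move=> k km; rewrite ltNge; apply: contraTN km => Zk; rewrite -leqNgt min_m.
rewrite (passage_time_finite wm Zm) poweR_EFin.
rewrite -(partial m wm) (nneseries_split 0%N m); last by move=> k _; exact: u0.
rewrite [X in (_ + X)%E]eseries0 ?adde0// => k mk _.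
rewrite /u indicE memNset ?mule0// => /(_ m); rewrite ltnS => /(_ mk).
by rewrite ltNge Zm.
Qed.

Lemma past_event_above (R : realType) (S : finType) (Omega : Type)
    (Z : nat -> Omega -> R * S) (x : R) (n : nat) :
  past_event Z n (above Z x n.+1).
Proof. by move=> w w' H wn k kn; rewrite -H//; exact: wn. Qed.

(** Summing the drift condition along the chain up to the passage time bounds
    [sum_n powR_step s n * P (tau > n)], which is the [s]-th moment of the
    passage time by summation by parts. *)
Lemma passage_time_moment (R : realType) (S : finType) (Sigma : set (R * S))
  (d : measure_display) (Omega : measurableType d)
  (P : R * S -> probability Omega R) (Z : nat -> Omega -> R * S) (x s : R)
  (G : nat -> R * S -> R) (z : R * S) :
  half_strip Sigma -> markov_chain Sigma P Z -> 0 < s ->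
  (forall n y, 0 <= G n y) ->
  (forall n y, Sigma y -> x < y.1 ->
    (\int[P y]_w (G n.+1 (Z 1%N w))%:E + (powR_step s n)%:E <= (G n y)%:E)%E) ->
  Sigma z -> (\int[P z]_w (passage_time Z x w `^ s) <= (G 0%N z)%:E)%E.
Proof.
move=> strip Zm s0 G0 drift Sz.
have mabove n : measurable (above Z x n).
  case: n => [|n].
    by rewrite (_ : above Z x 0 = setT)//; apply/seteqP; split.
  exact: measurable_past_event strip Zm (@past_event_above _ _ _ Z x n).
have mG n : measurable_fun setT (fun w => (G n (Z n w))%:E).
  exact: (measurable_fun_state n (fun y => (G n y)%:E) strip Zm).
have G0E n y : (0 <= (G n y)%:E)%E by rewrite lee_fin.
have a0 n : (0 <= (powR_step s n)%:E)%E by rewrite lee_fin powR_step_ge0 ?ltW.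
have partial N : (\sum_(0 <= n < N) (powR_step s n)%:E * P z (above Z x n.+1) +
    \int[P z]_(w in above Z x N) (G N (Z N w))%:E <= (G 0%N z)%:E)%E.
  elim: N => [|N IH].
    rewrite big_geq// add0e (_ : above Z x 0 = setT); last first.
      by apply/seteqP; split.
    have mz := chain_meas Zm 0 z.
    rewrite (ae_eq_integral (cst (G 0%N z)%:E))//; last first.
      exists (~` [set w | Z 0%N w = z]); split; first exact: measurableC.
        apply: (etrans (probability_setC (P z) mz)).
        by rewrite (chain_init Zm Sz) subee.
      by move=> w /= H Zw; apply: H => _; rewrite Zw.
    rewrite integral_cst// [X in (_ * X <= _)%E](_ : _ = 1%E) ?mule1//.
    exact: probability_setT.
  apply: le_trans IH; rewrite big_nat_recr//= -addeA leeD2l//.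
  apply: (@le_trans _ _ (\int[P z]_(w in above Z x N.+1) (G N (Z N w))%:E)%E).
    rewrite (markov_property (F := fun y => (G N.+1 y)%:E) strip Zm Sz
      (@past_event_above _ _ _ Z x N))//.
    rewrite -integral_cst// -ge0_integralD//; last first.
    - exact: (measurable_fun_state N (fun y => \int[P y]_w' (G N.+1 (Z 1%N w'))%:E)%E strip Zm).
    - by move=> w _; apply: integral_ge0.
    - by move=> w _; exact: a0.
    apply: ge0_le_integral => //.
    - by move=> w _; apply: adde_ge0; [exact: a0|exact: integral_ge0].
    - apply: emeasurable_funD => //.
      exact: (measurable_fun_state N (fun y => \int[P y]_w' (G N.+1 (Z 1%N w'))%:E)%E strip Zm).
    - exact: measurable_funTS.
    - move=> w wN; rewrite addeC; apply: drift; first exact: chain_state Zm _ _.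
      exact: wN.
  apply: ge0_subset_integral => //; first exact: measurable_funTS.
  by move=> w wN k kN; apply: wN; exact: ltnW.
under eq_integral do rewrite passage_time_powR//.
rewrite integral_nneseries//; last 2 first.
- by move=> n; apply: measurable_funeM; apply/measurable_EFinP.
- by move=> n w _; rewrite mule_ge0.
rewrite (eq_eseriesr (g := fun n => (powR_step s n)%:E * P z (above Z x n.+1))%E).
  apply: lime_le.
    by apply: is_cvg_nneseries => n _ _; rewrite mule_ge0.
  near=> N; apply: le_trans (partial N); rewrite leeDl//.
  exact: integral_ge0.
move=> n _; rewrite ge0_integralZl// ?integral_indic ?setIT//.
exact/measurable_EFinP.
Unshelve. all: by end_near.
Qed.

(** * Drift of the Lyapunov function *)

Lemma Rintegral_sum d (T : measurableType d) (R : realType)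
    (mu : {measure set T -> \bar R}) (I : Type) (r : seq I) (f : I -> T -> R) :
  (forall i, mu.-integrable setT (EFin \o f i)) ->
  \int[mu]_w \sum_(i <- r) f i w = \sum_(i <- r) \int[mu]_w f i w.
Proof.
move=> fi; elim: r => [|i r IH].
  by under eq_Rintegral do rewrite big_nil; rewrite Rintegral_cst// mul0r big_nil.
under eq_Rintegral do rewrite big_cons.
rewrite big_cons -IH RintegralD//.
have := integrable_sum measurableT r (P := xpredT) (fun i _ => fi i).
by apply: eq_integrable => // w _ /=; rewrite sumEFin.
Qed.

Lemma expn_le_1Dpow (R : realType) (u p : R) (n : nat) :
  0 <= u -> n%:R <= p -> u ^+ n <= 1 + u `^ p.
Proof.
move=> u0 np; have [u1|u1] := leP u 1.
  by rewrite (le_trans (exprn_ile1 n u0 u1))// lerDl powR_ge0.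
rewrite -powR_mulrn// (le_trans (ler_powR (ltW u1) np))//.
by rewrite lerDr.
Qed.

Lemma increment_integrable (R : realType) (S : finType) (Sigma : set (R * S))
  (d : measure_display) (Omega : measurableType d)
  (P : R * S -> probability Omega R) (Z : nat -> Omega -> R * S) (p Cp : R)
  (z : R * S) (g : R -> R) :
  half_strip Sigma -> markov_chain Sigma P Z ->
  (\int[P z]_w (`|(Z 1%N w).1 - z.1| `^ p)%:E <= Cp%:E)%E ->
  (forall t, `|g t| <= 1 + `|t| `^ p) ->
  (P z).-integrable setT (EFin \o (fun w => g ((Z 1%N w).1 - z.1))).
Proof.
move=> strip Zm moment gp.
have ip : (P z).-integrable setT
    (EFin \o (fun w => `|(Z 1%N w).1 - z.1| `^ p)).
  apply/integrableP; split.
    exact: (measurable_fun_state 1%N (fun y => (`|y.1 - z.1| `^ p)%:E) strip Zm).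
  rewrite (eq_integral (fun w => (`|(Z 1%N w).1 - z.1| `^ p)%:E)); last first.
    by move=> w _ /=; rewrite ger0_norm ?powR_ge0.
  by rewrite (le_lt_trans moment)// ltry.
apply: (le_integrable measurableT) (integrableD measurableT
  (finite_measure_integrable_cst (P z) 1 measurableT) ip).
  exact: (measurable_fun_state 1%N (fun y => (g (y.1 - z.1))%:E) strip Zm).
by move=> w _ /=; rewrite lee_fin [leRHS]ger0_norm ?addr_ge0 ?powR_ge0.
Qed.

(** The base of the Lyapunov function [(x^2 + b_i)^t]. *)
Definition lyapunov (R : realType) (S : finType) (b : S -> R) (z : R * S) : R :=
  z.1 ^+ 2 + b z.2.

Lemma Rintegral_line (R : realType) (S : finType) (Sigma : set (R * S))
  (d : measure_display) (Omega : measurableType d)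
  (P : R * S -> probability Omega R) (Z : nat -> Omega -> R * S)
  (b : S -> R) (x : R) (i : S) :
  half_strip Sigma -> markov_chain Sigma P Z ->
  (P (x, i)).-integrable setT (EFin \o (fun w => b (Z 1%N w).2)) /\
  \int[P (x, i)]_w b (Z 1%N w).2 = \sum_j line_prob P Z i j x * b j.
Proof.
move=> strip Zm; pose A j := [set w | (Z 1%N w).2 = j].
have mA j : measurable (A j).
  apply: (@measurable_past_event _ _ _ _ _ _ _ 1%N _ strip Zm).
  by move=> w w' H; rewrite /A /= H.
have iA j : (P (x, i)).-integrable setT (EFin \o (fun w => b j * \1_(A j) w)).
  exact: (integrableZl measurableT (b j) (integrable_indic (P (x, i)) (mA j))).
have bE w : b (Z 1%N w).2 = \sum_j b j * \1_(A j) w.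
  rewrite (bigD1 (Z 1%N w).2)//= indicE mem_set// mulr1 big1 ?addr0// => j ji.
  by rewrite indicE memNset ?mulr0// => /= E; rewrite E eqxx in ji.
split.
  have := integrable_sum measurableT (index_enum S) (P := xpredT) (fun j _ => iA j).
  by apply: eq_integrable => // w _ /=; rewrite sumEFin -bE.
under eq_Rintegral do rewrite bE.
rewrite Rintegral_sum//; apply: eq_bigr => j _.
rewrite RintegralZl//; last exact: integrable_indic.
rewrite mulrC; congr (_ * _).
by rewrite /Rintegral integral_indic// setIT.
Qed.

(** Taking expectations in [lyapunov_increment], whose conclusion is the last
    hypothesis with [a0 = (x^2 + b i)^s] and [a1 = s (x^2 + b i)^(s-1)]. *)
Lemma lyapunov_expectation (R : realType) (S : finType) (Sigma : set (R * S))
  (d : measure_display) (Omega : measurableType d)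
  (P : R * S -> probability Omega R) (Z : nat -> Omega -> R * S)
  (p Cp s eta K a0 a1 x : R) (i : S) (b : S -> R) :
  half_strip Sigma -> markov_chain Sigma P Z -> 2 < p -> 0 < x ->
  (\int[P (x, i)]_w (`|(Z 1%N w).1 - x| `^ p)%:E <= Cp%:E)%E ->
  0 <= a1 -> 0 <= K ->
  (forall D j, ((x + D) ^+ 2 + b j) `^ s <= a0 + a1 * (2 * x * D
    + (2 * s - 1) * D ^+ 2 + (b j - b i) + eta * (1 + D ^+ 2)
    + K * (x ^+ 2 * (`|D| / x) `^ p))) ->
  (\int[P (x, i)]_w (lyapunov b (Z 1%N w) `^ s)%:E <=
   (a0 + a1 * (2 * x * drift P Z i x + (2 * s - 1) * sq_incr P Z i x
     + (\sum_j line_prob P Z i j x * b j - b i) + eta * (1 + sq_incr P Z i x)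
     + K * Cp * x `^ (2 - p)))%:E)%E.
Proof.
move=> strip Zm p2 x0 moment a10 K0 H.
pose D w := (Z 1%N w).1 - x.
have i1 : (P (x, i)).-integrable setT (EFin \o D).
  apply: (increment_integrable (g := id) strip Zm moment) => t /=.
  by have := @expn_le_1Dpow R `|t| p 1; rewrite expr1; apply => //; lra.
have i2 : (P (x, i)).-integrable setT (EFin \o (fun w => D w ^+ 2)).
  apply: (increment_integrable (g := fun t => t ^+ 2) strip Zm moment) => t /=.
  by rewrite normrX; apply: expn_le_1Dpow => //; exact: ltW.
have ip : (P (x, i)).-integrable setT (EFin \o (fun w => `|D w| `^ p)).
  apply: (increment_integrable (g := fun t => `|t| `^ p) strip Zm moment) => t /=.
  by rewrite ger0_norm ?powR_ge0// lerDr.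
have [ib EB] := Rintegral_line b x i strip Zm.
pose m := \int[P (x, i)]_w (`|D w| `^ p).
have mC : m <= Cp.
  rewrite -lee_fin /m /Rintegral fineK ?integrable_fin_num//.
pose k0 := a0 + a1 * (eta - b i).
pose k1 := a1 * (2 * x); pose k2 := a1 * (2 * s - 1 + eta).
pose kp := a1 * K * x `^ (2 - p).
pose mu := P (x, i).
pose f3 w := a1 * b (Z 1%N w).2 + kp * `|D w| `^ p.
pose f2 w := k2 * D w ^+ 2 + f3 w.
pose f1 w := k1 * D w + f2 w.
pose f w := k0 + f1 w.
have Zl c g : mu.-integrable setT (EFin \o g) ->
    mu.-integrable setT (EFin \o (fun w => c * g w)).
  by move=> /(integrableZl measurableT c); apply: eq_integrable.
have Dl g h : mu.-integrable setT (EFin \o g) ->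
    mu.-integrable setT (EFin \o h) ->
    mu.-integrable setT (EFin \o (fun w => g w + h w)).
  by move=> ig /(integrableD measurableT ig); apply: eq_integrable.
have zb := Zl a1 _ ib; have zp := Zl kp _ ip.
have z2 := Zl k2 _ i2; have z1 := Zl k1 _ i1.
have z0 : mu.-integrable setT (EFin \o cst k0).
  exact: finite_measure_integrable_cst.
have j3 : mu.-integrable setT (EFin \o f3) := Dl _ _ zb zp.
have j2 : mu.-integrable setT (EFin \o f2) := Dl _ _ z2 j3.
have j1 : mu.-integrable setT (EFin \o f1) := Dl _ _ z1 j2.
have j0 : mu.-integrable setT (EFin \o f) := Dl _ _ z0 j1.
have intf : \int[mu]_w f w = k0 + (k1 * drift P Z i x +
    (k2 * sq_incr P Z i x +
     (a1 * (\sum_j line_prob P Z i j x * b j) + kp * m))).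
  rewrite (RintegralD measurableT z0 j1) (RintegralD measurableT z1 j2).
  rewrite (RintegralD measurableT z2 j3) (RintegralD measurableT zb zp).
  rewrite (RintegralZl k1 measurableT i1) (RintegralZl k2 measurableT i2).
  rewrite (RintegralZl a1 measurableT ib) (RintegralZl kp measurableT ip) EB.
  congr (_ + _); rewrite Rintegral_cst// -[RHS]mulr1; congr (_ * _).
  exact: (congr1 fine (probability_setT mu)).
have xp : x ^+ 2 * x `^ (- p) = x `^ (2 - p).
  by rewrite powRDn// powR_mulrn// ltW.
apply: (@le_trans _ _ (\int[P (x, i)]_w (f w)%:E)%E).
  apply: ge0_le_integral => //.
  - by move=> w _; rewrite lee_fin powR_ge0.
  - exact: (measurable_fun_state 1%N (fun y => (lyapunov b y `^ s)%:E) strip Zm).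
  - by case/integrableP : j0.
  - move=> w _; rewrite lee_fin /lyapunov.
    have := H (D w) (Z 1%N w).2.
    rewrite (_ : x + D w = (Z 1%N w).1); last by rewrite /D; ring.
    move=> /le_trans; apply.
    have -> : (`|D w| / x) `^ p = `|D w| `^ p * x `^ (- p).
      have xV : 0 <= x^-1 by rewrite invr_ge0 ltW.
      rewrite powRM//; congr (_ * _).
      by rewrite -(powR_inv1 (ltW x0)) -powRrM mulN1r.
    rewrite le_eqVlt; apply/orP; left; apply/eqP.
    rewrite /f /f1 /f2 /f3 /kp /k0 /k1 /k2 -xp; ring.
rewrite -(fineK (integrable_fin_num measurableT j0)) lee_fin.
rewrite [leLHS](_ : _ = \int[mu]_w f w)// intf.
have kpm : kp * m <= kp * Cp.
  by rewrite ler_wpM2l// /kp !mulr_ge0// powR_ge0.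
move: kpm; rewrite /kp /k0 /k1 /k2; lra.
Qed.

Lemma littleo_near (R : realType) (S : finType) (Sigma : set (R * S)) (i : S)
    (f g h : R -> R) :
  (forall x, (f x : R^o) = g x +o_(x \near line_infty Sigma i) (h x : R^o)) ->
  forall e : R, 0 < e ->
  \forall x \near line_infty Sigma i, `|f x - g x| <= e * `|h x|.
Proof. by move=> H; apply: (eqadd_some_oP (funext H)). Qed.

Lemma near_line (R : realType) (S : finType) (Sigma : set (R * S)) (i : S)
    (Q : set R) :
  (\forall x \near +oo, Q x) -> \forall x \near line_infty Sigma i, Q x.
Proof. by apply: filterS => x Qx _. Qed.

Lemma drift_cvg (R : realType) (S : finType) (Sigma : set (R * S)) (i : S)
    (mu : R -> R) (c : R) :
  (forall x, (mu x : R^o) = c / x +o_(x \near line_infty Sigma i) (x^-1 : R^o)) ->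
  x * mu x @[x --> line_infty Sigma i] --> c.
Proof.
move=> /(@littleo_near _ _ _ _ mu (fun x => c / x) (fun x => x^-1)) H.
apply/cvgrPdist_le => e e0.
have Hpos : \forall x \near line_infty Sigma i, 0 < x.
  by apply: near_line; exact: nbhs_pinfty_gt.
apply: filterS2 Hpos (H e e0) => x x0.
have xV : 0 < x^-1 by rewrite invr_gt0.
rewrite (gtr0_norm xV) ler_pdivlMr// => {H} ?.
rewrite distrC -[c](divfK (lt0r_neq0 x0)) [c / x * x]mulrC -mulrBr normrM.
by rewrite (gtr0_norm x0) mulrC.
Qed.

Lemma sq_incr_cvg (R : realType) (S : finType) (Sigma : set (R * S)) (i : S)
    (f : R -> R) (l : R) :
  (forall x, (f x : R^o) = l +o_(x \near line_infty Sigma i) (1 : R^o)) ->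
  f x @[x --> line_infty Sigma i] --> l.
Proof.
move=> /(@littleo_near _ _ _ _ f (fun=> l) (fun=> 1)) H.
apply/cvgrPdist_le => e e0; apply: filterS (H e e0) => x.
by rewrite normr1 mulr1 distrC.
Qed.

Lemma powR_neg_cvg0 (R : realType) (r : R) : r < 0 ->
  x `^ r @[x --> +oo] --> 0.
Proof.
move=> r0; apply/cvgrPdist_le => e e0; near=> x.
have x1 : e `^ r^-1 <= x by near: x; exact: nbhs_pinfty_ge.
have p0 : 0 < e `^ r^-1 by rewrite powR_gt0.
have x0 : 0 < x by exact: lt_le_trans x1.
rewrite sub0r normrN ger0_norm ?powR_ge0//.
have -> : e = (e `^ r^-1) `^ r by rewrite -powRrM mulVf ?lt_eqF// powRr1// ltW.
have rE t : t `^ r = (t `^ (- r))^-1 by rewrite -powRN opprK.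
rewrite (rE x) (rE (e `^ r^-1)) lef_pV2 ?posrE ?powR_gt0//.
by rewrite ge0_ler_powR ?nnegrE ?oppr_ge0// ltW.
Unshelve. all: by end_near. Qed.

(** The factor of [a1] in [lyapunov_expectation] converges to
    [a + eta (1 + s2)] along each line, where [a < 0] does not depend on the
    line by the choice of [b], and [eta] is as small as desired. *)
Lemma lyapunov_drift (R : realType) (S : finType) (Sigma : set (R * S))
  (d : measure_display) (Omega : measurableType d)
  (P : R * S -> probability Omega R) (Z : nat -> Omega -> R * S)
  (p Cp s a : R) (q : S -> S -> R) (c s2 b : S -> R) :
  half_strip Sigma -> markov_chain Sigma P Z -> 2 < p ->
  (forall z, Sigma z ->
    (\int[P z]_w (`|(Z 1%N w).1 - z.1| `^ p)%:E <= Cp%:E)%E) ->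
  (forall i j, line_prob P Z i j x @[x --> line_infty Sigma i] --> q i j) ->
  (forall i, 0 <= s2 i) ->
  (forall i x, (drift P Z i x : R^o) =
    c i / x +o_(x \near line_infty Sigma i) (x^-1 : R^o)) ->
  (forall i x, (sq_incr P Z i x : R^o) =
    s2 i +o_(x \near line_infty Sigma i) (1 : R^o)) ->
  0 < s -> 2 * s <= p -> a < 0 -> (forall i, 0 <= b i) ->
  (forall i, 2 * c i + (2 * s - 1) * s2 i + (\sum_j q i j * b j - b i) = a) ->
  exists2 e : R, 0 < e & \forall x \near +oo, forall i, Sigma (x, i) ->
    (\int[P (x, i)]_w (lyapunov b (Z 1%N w) `^ s)%:E <=
     (lyapunov b (x, i) `^ s - e * lyapunov b (x, i) `^ (s - 1))%:E)%E.
Proof.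
move=> strip Zm p2 moments q_lim s2_ge0 drift_as sq_as s0 sp a0 b0 poisson.
pose M := 1 + \sum_i s2 i.
have s2M i : 1 + s2 i <= M.
  by rewrite /M lerD2l (bigD1 i)//= lerDl sumr_ge0.
have M0 : 0 < M by rewrite /M ltr_wpDr// sumr_ge0.
pose eta := - a / (4 * M).
have eta0 : 0 < eta by rewrite /eta divr_gt0 ?oppr_gt0 ?mulr_gt0.
pose B := \sum_i b i.
have bB i : 0 <= b i <= B.
  by rewrite b0/= /B (bigD1 i)//= lerDl sumr_ge0.
have B0 : 0 <= B by exact: sumr_ge0.
have [K [x0 [K0 x01 increment]]] := lyapunov_increment s0 p2 sp B0 eta0.
pose h i x := 2 * x * drift P Z i x + (2 * s - 1) * sq_incr P Z i x
     + (\sum_j line_prob P Z i j x * b j - b i) + eta * (1 + sq_incr P Z i x)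
     + K * Cp * x `^ (2 - p).
have h_lim i : h i x @[x --> line_infty Sigma i] --> a + eta * (1 + s2 i).
  rewrite -(poisson i) /h.
  have -> : 2 * c i + (2 * s - 1) * s2 i + (\sum_j q i j * b j - b i) +
      eta * (1 + s2 i) = 2 * c i + (2 * s - 1) * s2 i +
      (\sum_j q i j * b j - b i) + eta * (1 + s2 i) + K * Cp * 0 by ring.
  have sq := sq_incr_cvg (sq_as i).
  apply: cvgD; last first.
    by apply: cvgMl_tmp; apply: cvg_within_filter; apply: powR_neg_cvg0; lra.
  apply: cvgD; last by apply: cvgMl_tmp; apply: cvgD => //; exact: cvg_cst.
  apply: cvgD; last first.
    apply: cvgB; last exact: cvg_cst.
    apply: cvg_big => [|j _]; first exact: add_continuous.
    by apply: cvgMr_tmp; exact: q_lim.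
  apply: cvgD; last exact: cvgMl_tmp.
  under eq_fun do rewrite -mulrA.
  by apply: cvgMl_tmp; exact: drift_cvg.
have eta_small i : a + eta * (1 + s2 i) < a / 2.
  have : eta * (1 + s2 i) <= eta * M by rewrite ler_pM2l.
  have -> : eta * M = - a / 4 by rewrite /eta; field; rewrite gt_eqF.
  by lra.
exists (- (a / 2) * s); first by rewrite mulr_gt0//; lra.
have near_h i : \forall x \near +oo, Sigma (x, i) -> h i x < a / 2.
  exact: (cvgr_lt _ (h_lim i) _ (eta_small i)).
near=> x.
have xx0 : x0 <= x by near: x; apply: nbhs_pinfty_ge; rewrite num_real.
have hx i : Sigma (x, i) -> h i x < a / 2.
  by move: i; near: x; exact: filter_forall.
move=> i Sxi.
have x_gt0 : 0 < x by exact: lt_le_trans (lt_le_trans ltr01 x01) xx0.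
set w := lyapunov b (x, i).
have w0 : 0 < w by rewrite /w /lyapunov/= ltr_wpDr// exprn_gt0.
have a10 : 0 <= s * w `^ (s - 1) by rewrite mulr_ge0 ?powR_ge0// ltW.
have H := lyapunov_expectation (a0 := w `^ s) strip Zm p2 x_gt0 (moments _ Sxi)
  a10 K0 (fun D j => increment x D (b i) (b j) xx0 (bB i) (bB j)).
apply: (le_trans H); rewrite lee_fin lerD2l -/(h i x).
have := ler_wpM2l a10 (ltW (hx i Sxi)); lra.
Unshelve. all: by end_near. Qed.

(** * From the Lyapunov function to moments *)

Lemma powR_antitone (R : realType) (u v r : R) :
  r <= 0 -> 0 < u -> u <= v -> v `^ r <= u `^ r.
Proof.
move=> r0 u0 uv; have := powR_le_lower_exponent u0 uv r0.
by rewrite subr0 powRr0 mulr1.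
Qed.

Lemma powR_tangent_scale (R : realType) (e m x : R) : 0 < m ->
  m `^ e * (1 + e * (x / m - 1)) = m `^ e + e * m `^ (e - 1) * (x - m).
Proof.
move=> m0; have -> : m `^ e = m * m `^ (e - 1).
  by rewrite -{2}(powRr1 (ltW m0)) -powRDn// addrC subrK.
by field; rewrite gt_eqF.
Qed.

Lemma powR_tangent_ge1_at (R : realType) (s m x : R) : 1 <= s -> 0 < m -> 0 <= x ->
  m `^ s + s * m `^ (s - 1) * (x - m) <= x `^ s.
Proof.
move=> s1 m0 x0; rewrite -powR_tangent_scale//.
have {2}-> : x = m * (x / m) by field; rewrite gt_eqF.
have xm : 0 <= x / m by rewrite divr_ge0// ltW.
by rewrite (powRM _ (ltW m0) xm) ler_wpM2l ?powR_ge0 ?powR_tangent_ge1.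
Qed.

Lemma powR_tangent_le0_at (R : realType) (e m x : R) : e <= 0 -> 0 < m -> 0 < x ->
  m `^ e + e * m `^ (e - 1) * (x - m) <= x `^ e.
Proof.
move=> e0 m0 x0; rewrite -powR_tangent_scale//.
have {2}-> : x = m * (x / m) by field; rewrite gt_eqF.
have xm : 0 < x / m by rewrite divr_gt0.
by rewrite (powRM _ (ltW m0) (ltW xm)) ler_wpM2l ?powR_ge0 ?powR_tangent_le0.
Qed.

(** [v |-> (v^(1/s) + a)^s] is concave for [1 <= s]; this is its tangent bound
    at [w^s], obtained by averaging two tangent bounds of the convex function
    [t^s] at [v + a]. *)
Lemma powR_shift_concave (R : realType) (s v w a : R) :
  1 <= s -> 0 <= v -> 0 < w -> 0 < a ->
  (v + a) `^ s <= (w + a) `^ (s - 1) * (w `^ (1 - s) * v `^ s + a).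
Proof.
move=> s1 v0 w0 a0; set m := v + a; set t := w + a.
have m0 : 0 < m by rewrite /m ltr_wpDl.
have t0 : 0 < t by rewrite /t addr_gt0.
have xv : 0 <= t / w * v by rewrite mulr_ge0// divr_ge0// ltW.
have H1 := powR_tangent_ge1_at s1 m0 xv.
have H2 := powR_tangent_ge1_at s1 m0 (ltW t0).
have l1 : 0 <= w / t by rewrite divr_ge0// ltW.
have l2 : 0 <= a / t by rewrite divr_ge0// ltW.
have := lerD (ler_wpM2l l1 H1) (ler_wpM2l l2 H2).
have -> : w / t * (m `^ s + s * m `^ (s - 1) * (t / w * v - m)) +
    a / t * (m `^ s + s * m `^ (s - 1) * (t - m)) = m `^ s.
  have -> : m = v + a by [].
  by rewrite /t; field; rewrite !gt_eqF//= addr_gt0.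
move=> /le_trans; apply.
have wV : 0 <= w^-1 by rewrite invr_ge0 ltW.
have tw : 0 <= t / w by rewrite divr_ge0// ltW.
rewrite (powRM _ tw v0) (powRM _ (ltW t0) wV).
have s0 : 0 < s by exact: lt_le_trans s1.
have -> : t `^ s = t * t `^ (s - 1) by rewrite mulr_powRB1// ltW.
have -> : w^-1 `^ s = w^-1 * w `^ (1 - s).
  rewrite -(powR_inv1 (ltW w0)) -powRrM -powRDn//.
  by congr (_ `^ _); ring.
by rewrite le_eqVlt; apply/orP; left; apply/eqP; field; rewrite !gt_eqF.
Qed.

Lemma integral_le_affine (R : realType) (S : finType) (Sigma : set (R * S))
  (d : measure_display) (Omega : measurableType d)
  (P : R * S -> probability Omega R) (Z : nat -> Omega -> R * S)
  (z : R * S) (f g : R * S -> R) (A B v : R) :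
  half_strip Sigma -> markov_chain Sigma P Z ->
  (forall y, 0 <= f y) -> (forall y, 0 <= g y) -> 0 <= A -> 0 <= B ->
  (forall y, g y <= A * f y + B) ->
  (\int[P z]_w (f (Z 1%N w))%:E <= v%:E)%E ->
  (\int[P z]_w (g (Z 1%N w))%:E <= (A * v + B)%:E)%E.
Proof.
move=> strip Zm f0 g0 A0 B0 gf fv.
have mst h : measurable_fun setT (fun w => (h (Z 1%N w))%:E : \bar R).
  exact: (measurable_fun_state 1%N (fun y => (h y)%:E) strip Zm).
apply: (@le_trans _ _ (\int[P z]_w (A%:E * (f (Z 1%N w))%:E + cst B%:E w))%E).
  apply: ge0_le_integral => //.
  - by move=> w _; rewrite lee_fin.
  - by apply: emeasurable_funD => //; apply: measurable_funeM.
  - by move=> w _; rewrite -EFinM -EFinD lee_fin.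
rewrite ge0_integralD//; last 2 first.
- by move=> w _; rewrite -EFinM lee_fin mulr_ge0.
- by apply: measurable_funeM.
rewrite EFinD; apply: leeD.
  rewrite ge0_integralZl_EFin//; last by move=> w _; rewrite lee_fin.
  by rewrite EFinM lee_wpmul2l.
rewrite integral_cst// -[leRHS]mule1 lee_wpmul2l//.
exact: probability_le1.
Qed.

Lemma powR_step_le1 (R : realType) (s : R) n : 0 < s -> s <= 1 ->
  powR_step s n <= n.+1%:R `^ (s - 1).
Proof.
move=> s0 s1; rewrite /powR_step -(mulr_powRB1 (ler0n R n.+1) s0) -[in X in X * _]natr1.
suff : n%:R * n.+1%:R `^ (s - 1) <= n%:R `^ s :> R by lra.
case: n => [|n]; first by rewrite mul0r powR_ge0.
rewrite -(mulr_powRB1 (ler0n _ _) s0) ler_wpM2l//.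
by apply: powR_antitone; rewrite ?subr_le0 ?ltr0Sn ?ler_nat.
Qed.

(** With [W^s] of drift at most [- e W^(s-1)], the flow of [v' = - e v^(1-1/s)]
    reaches the value [v = W^s] at time [n] from [(W + a n)^s] at time [0], for
    [a = e / s].  As this is concave in [v], Jensen's inequality makes it a
    supermartingale; half of the speed leaves room for the steps of [n^s]. *)
Lemma passage_moment_ge1 (R : realType) (S : finType) (Sigma : set (R * S))
  (d : measure_display) (Omega : measurableType d)
  (P : R * S -> probability Omega R) (Z : nat -> Omega -> R * S)
  (W : R * S -> R) (s e x : R) (z : R * S) :
  half_strip Sigma -> markov_chain Sigma P Z -> 1 <= s -> 0 < e ->
  (forall y, 0 <= W y) ->
  (forall y, Sigma y -> x < y.1 -> 0 < W y /\
    (\int[P y]_w (W (Z 1%N w) `^ s)%:E <=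
     (W y `^ s - e * W y `^ (s - 1))%:E)%E) ->
  Sigma z -> (\int[P z]_w (passage_time Z x w `^ s) < +oo)%E.
Proof.
move=> strip Zm s1 e0 W0 drift Sz.
have s0 : 0 < s by exact: lt_le_trans s1.
(* Half of the speed e / s of the flow. *)
pose a := e / (2 * s); have a0 : 0 < a by rewrite divr_gt0// mulr_gt0.
have aE : s * a = e / 2 by rewrite /a; field; rewrite gt_eqF.
pose k := e / 2 * a `^ (s - 1) / s.
have k0 : 0 < k by rewrite divr_gt0// mulr_gt0 ?powR_gt0// divr_gt0.
pose G (n : nat) y := k^-1 * (W y + a * n%:R) `^ s.
have G0 n y : 0 <= G n y by rewrite mulr_ge0 ?invr_ge0 ?powR_ge0 ?ltW.
suff H : (\int[P z]_w (passage_time Z x w `^ s) <= (G 0%N z)%:E)%E.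
  by rewrite (le_lt_trans H)// ltry.
apply: (passage_time_moment strip Zm s0 G0) => // n y Sy xy.
have [w0 dr] := drift y Sy xy; set w := W y in w0 dr *.
pose c := a * n.+1%:R; have c0 : 0 < c by rewrite mulr_gt0.
pose t := w + c; have t0 : 0 < t by rewrite addr_gt0.
pose A := k^-1 * (t `^ (s - 1) * w `^ (1 - s)); pose B := k^-1 * (t `^ (s - 1) * c).
have kV : 0 <= k^-1 by rewrite invr_ge0 ltW.
have A0 : 0 <= A := mulr_ge0 kV (mulr_ge0 (powR_ge0 _ _) (powR_ge0 _ _)).
have B0 : 0 <= B := mulr_ge0 kV (mulr_ge0 (powR_ge0 _ _) (ltW c0)).
have GAB y' : G n.+1 y' <= A * W y' `^ s + B.
  have -> : A * W y' `^ s + B = k^-1 * (t `^ (s - 1) * (w `^ (1 - s) * W y' `^ s + c)).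
    by rewrite /A /B; ring.
  by rewrite ler_wpM2l//; exact: powR_shift_concave.
have H := integral_le_affine strip Zm (fun y => powR_ge0 (W y) s) (G0 n.+1)
  A0 B0 GAB dr.
apply: (le_trans (leeD H (lexx _))); rewrite -EFinD lee_fin.
have ws : w `^ (1 - s) * w `^ s = w.
  by rewrite -powRDn// subrK powRr1// ltW.
have ws1 : w `^ (1 - s) * w `^ (s - 1) = 1.
  by rewrite -powRDn// (_ : 1 - s + (s - 1) = 0) ?powRr0//; ring.
have ts : t `^ s = t * t `^ (s - 1) by rewrite mulr_powRB1// ltW.
have -> : A * (w `^ s - e * w `^ (s - 1)) + B =
    k^-1 * (t `^ s - e * t `^ (s - 1)).
  have -> : A * (w `^ s - e * w `^ (s - 1)) + B = k^-1 * t `^ (s - 1) *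
    (w `^ (1 - s) * w `^ s - e * (w `^ (1 - s) * w `^ (s - 1)) + c).
    by rewrite /A /B; ring.
  by rewrite ws ws1 ts /t; ring.
rewrite -(ler_pM2l k0) mulrDr !mulrA divff ?gt_eqF// !mul1r.
have tan1 : t `^ s - e / 2 * t `^ (s - 1) <= (w + a * n%:R) `^ s.
  have wn0 : 0 <= w + a * n%:R.
    by rewrite addr_ge0 ?(ltW w0)// mulr_ge0// ltW.
  have := powR_tangent_ge1_at s1 t0 wn0.
  have -> : w + a * n%:R - t = - a by rewrite /t /c -natr1; ring.
  by rewrite mulrAC mulrN aE; clear; lra.
have tan2 : powR_step s n <= s * n.+1%:R `^ (s - 1).
  have := @powR_tangent_ge1_at R s n.+1%:R n%:R s1 (ltr0Sn _ _) (ler0n _ _).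
  rewrite /powR_step -[X in n%:R - X]natr1; lra.
have tn : a `^ (s - 1) * n.+1%:R `^ (s - 1) <= t `^ (s - 1).
  rewrite -(powRM _ (ltW a0) (ler0n _ _)).
  apply: ge0_ler_powR; rewrite ?subr_ge0// ?nnegrE; [exact: ltW|exact: ltW|].
  by rewrite /t lerDr ltW.
have kstep : k * powR_step s n <= e / 2 * t `^ (s - 1).
  apply: (@le_trans _ _ (k * (s * n.+1%:R `^ (s - 1)))).
    by rewrite ler_pM2l.
  have -> : k * (s * n.+1%:R `^ (s - 1)) =
      e / 2 * (a `^ (s - 1) * n.+1%:R `^ (s - 1)).
    by rewrite /k; field; rewrite gt_eqF.
  by rewrite ler_pM2l// divr_gt0.
by move: tan1 kstep; lra.
Qed.

(** For [s < s' <= 1], the function [W^s'] is weighted by a slowly decreasing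
    factor.  As long as [W] is at most of order [n], the drift
    [- e W^(s'-1)] of [W^s'] is at least of the order of the step [n^(s-1)];
    for larger [W], the decrease of the weight times [W^s'] is. *)
Lemma passage_moment_lt1 (R : realType) (S : finType) (Sigma : set (R * S))
  (d : measure_display) (Omega : measurableType d)
  (P : R * S -> probability Omega R) (Z : nat -> Omega -> R * S)
  (W : R * S -> R) (s s' e x : R) (z : R * S) :
  half_strip Sigma -> markov_chain Sigma P Z -> 0 < s -> s < s' -> s' <= 1 ->
  0 < e -> (forall y, 0 <= W y) ->
  (forall y, Sigma y -> x < y.1 -> 0 < W y /\
    (\int[P y]_w (W (Z 1%N w) `^ s')%:E <=
     (W y `^ s' - e * W y `^ (s' - 1))%:E)%E) ->
  Sigma z -> (\int[P z]_w (passage_time Z x w `^ s) < +oo)%E.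
Proof.
move=> strip Zm s0 ss' s'1 e0 W0 drift Sz.
pose r := s - s'; have r0 : r < 0 by rewrite subr_lt0.
have s1 : s - 1 <= 0 by rewrite subr_le0 (le_trans (ltW ss')).
have s_le1 : s <= 1 by rewrite (le_trans (ltW ss')).
have s'0 : 0 < s' by exact: lt_trans ss'.
pose k := Num.min (- r) e / 2.
have k2 : 2 * k = Num.min (- r) e by rewrite /k mulrC divfK.
have k0 : 0 < k by rewrite divr_gt0// lt_min oppr_gt0 r0.
have kV : 0 <= k^-1 by rewrite invr_ge0 ltW.
pose u (n : nat) := 1 + n.+1%:R `^ r.
have u0 n : 0 <= u n by rewrite addr_ge0 ?powR_ge0.
pose G n y := k^-1 * (u n * W y `^ s').
have G0 n y : 0 <= G n y by rewrite !mulr_ge0 ?powR_ge0.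
suff H : (\int[P z]_w (passage_time Z x w `^ s) <= (G 0%N z)%:E)%E.
  by rewrite (le_lt_trans H)// ltry.
apply: (passage_time_moment strip Zm s0 G0) => // n y Sy xy.
have [w0 dr] := drift y Sy xy; set w := W y in w0 dr *.
pose A := k^-1 * u n.+1; have A0 : 0 <= A := mulr_ge0 kV (u0 n.+1).
have GAB y' : G n.+1 y' <= A * W y' `^ s' + 0 by rewrite addr0 /A -mulrA.
have H := integral_le_affine strip Zm (fun y => powR_ge0 (W y) s') (G0 n.+1)
  A0 (lexx 0) GAB dr.
apply: (le_trans (leeD H (lexx _))); rewrite -EFinD lee_fin addr0.
rewrite -(ler_pM2l k0) mulrDr /A /G !mulrA divff ?gt_eqF// !mul1r.
set N : R := n.+2%:R; have N0 : 0 < N by rewrite ltr0Sn.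
have step : k * powR_step s n <= k * (2 * N `^ (s - 1)).
  rewrite ler_pM2l//; apply: (@le_trans _ _ (n.+1%:R `^ (s - 1))).
    exact: powR_step_le1.
  have N2 : N <= 2 * n.+1%:R by rewrite /N -natrM ler_nat mul2n doubleS !ltnS -addnn leq_addl.
  have := powR_antitone s1 N0 N2; rewrite powRM//.
  have h : 2^-1 <= 2 `^ (s - 1) :> R.
    rewrite -powR_inv1// ler_powR//; lra.
  have := ler_wpM2r (powR_ge0 n.+1%:R (s - 1)) h.
  by move=> *; lra.
have weight : - r * N `^ (r - 1) <= u n - u n.+1.
  have := @powR_tangent_le0_at R r N n.+1%:R (ltW r0) N0 (ltr0Sn _ _).
  have -> : n.+1%:R - N = -1 by rewrite /N -(natr1 n.+1); ring.
  by rewrite /u -/N; lra.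
have main : k * (2 * N `^ (s - 1)) <=
    (u n - u n.+1) * w `^ s' + e * w `^ (s' - 1).
  have e1 : 0 <= (u n - u n.+1) * w `^ s'.
    rewrite mulr_ge0 ?powR_ge0// (le_trans _ weight)// mulr_ge0 ?powR_ge0//.
    by rewrite oppr_ge0 ltW.
  have e2 : 0 <= e * w `^ (s' - 1) by rewrite mulr_ge0 ?powR_ge0// ltW.
  have kNs : k * (2 * N `^ (s - 1)) = Num.min (- r) e * N `^ (s - 1).
    by rewrite -k2; ring.
  have [wN|Nw] := leP w N.
    rewrite kNs -[leLHS]add0r lerD//.
    rewrite ler_pM ?powR_ge0 ?ge_min ?lexx ?orbT//.
      by rewrite -k2 mulr_ge0 ?ltW.
    apply: (@le_trans _ _ (N `^ (s' - 1))).
      by rewrite ler_powR ?ler1n// lerB// ltW.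
    by apply: powR_antitone => //; rewrite subr_le0.
  rewrite kNs -[leLHS]addr0 lerD//.
  have -> : N `^ (s - 1) = N `^ (r - 1) * N `^ s'.
    by rewrite -powRDn//; congr (_ `^ _); rewrite /r; ring.
  rewrite mulrA ler_pM ?powR_ge0//.
  - by rewrite mulr_ge0 ?powR_ge0// -k2 mulr_ge0// ltW.
  - by apply: le_trans weight; rewrite ler_wpM2r ?powR_ge0// ge_min lexx.
  - by apply: ge0_ler_powR; rewrite ?nnegrE ?ltW.
have u1 : e * w `^ (s' - 1) <= u n.+1 * (e * w `^ (s' - 1)).
  by rewrite ler_peMl ?(mulr_ge0 (ltW e0) (powR_ge0 _ _))// /u lerDl powR_ge0.
by move: step main u1; lra.
Qed.

(** * Moments of passage times of the half-strip chain *)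

Unset Implicit Arguments.
Set Strict Implicit.

Theorem theorem3p1p2 (R : realType) (S : finType) (S_nonempty : (0 < #|S|)%N)
  (Sigma : set (R * S)) (Sigma_strip : half_strip Sigma)
  (d : measure_display) (Omega : measurableType d)
  (P : R * S -> probability Omega R) (Z : nat -> Omega -> R * S)
  (Z_markov : markov_chain Sigma P Z)
  (Z_irr : irreducible_chain Sigma P Z)
  (p Cp : R) (p_gt2 : 2 < p)
  (moments : forall z, Sigma z ->
    (\int[P z]_w (`|(Z 1%N w).1 - z.1| `^ p)%:E <= Cp%:E)%E)
  (q : S -> S -> R)
  (q_lim : forall i j,
    line_prob P Z i j x @[x --> line_infty Sigma i] --> q i j)
  (q_stoch : stochastic q) (q_irr : irreducible_matrix q)
  (pi : S -> R) (pi_stat : stationary q pi)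
  (c s2 : S -> R) (s2_ge0 : forall i, 0 <= s2 i)
  (s2_neq0 : exists i, s2 i != 0)
  (drift_asymp : forall i x, (drift P Z i x : R^o) =
    c i / x +o_(x \near line_infty Sigma i) (x^-1 : R^o))
  (sq_incr_asymp : forall i x, (sq_incr P Z i x : R^o) =
    s2 i +o_(x \near line_infty Sigma i) (1 : R^o))
  (theta : R) (theta_gt0 : 0 < theta)
  (theta_drift : \sum_i (2 * c i + (2 * theta - 1) * s2 i) * pi i < 0)
  (s : R) (s_ge0 : 0 <= s) (s_le : s <= Num.min theta (p / 2)) :
  \forall x \near +oo, forall z, Sigma z ->
    (\int[P z]_w (passage_time Z x w `^ s) < +oo)%E.
Proof.
have P_le1 z : (P z setT <= 1)%E by exact: probability_le1.
have [->|s_neq0] := eqVneq s 0.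
  apply: nearW => x z Sz; under eq_integral do rewrite poweRe0.
  by rewrite integral_cst// mul1e (le_lt_trans (P_le1 z))// ltry.
have s_gt0 : 0 < s by rewrite lt_def s_neq0.
move: s_le; rewrite le_min => /andP[s_theta s_p].
have lyapunov_exists t : 0 < t -> 2 * t <= p ->
    \sum_i (2 * c i + (2 * t - 1) * s2 i) * pi i < 0 ->
    exists (W : R * S -> R) (e x0 : R), [/\ 0 < e, forall y, 0 <= W y &
      forall y, Sigma y -> x0 < y.1 -> 0 < W y /\
      (\int[P y]_w (W (Z 1%N w) `^ t)%:E <=
       (W y `^ t - e * W y `^ (t - 1))%:E)%E].
  move=> t0 tp neg.
  have [b b0 poisson] := poisson_equation
    (fun i => 2 * c i + (2 * t - 1) * s2 i) q_stoch q_irr pi_stat.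
  have [e e0 [M [_ drift]]] := lyapunov_drift Sigma_strip Z_markov p_gt2 moments
    q_lim s2_ge0 drift_asymp sq_incr_asymp t0 tp neg b0 poisson.
  exists (lyapunov b), e, (Num.max M 0); split=> // [y|[y i] Sy].
    by rewrite addr_ge0 ?sqr_ge0.
  rewrite gt_max => /andP[My y0]; split; last exact: drift.
  by rewrite /lyapunov ltr_wpDr// exprn_gt0.
have [s1|s1] := leP 1 s.
  have [||W [e [x0 [e0 W0 drift]]]] := lyapunov_exists s s_gt0.
  - lra.
  - apply: le_lt_trans theta_drift; apply: ler_sum => i _.
    have [pi0 _ _] := pi_stat.
    rewrite ler_wpM2r// lerD2l ler_wpM2r//; lra.
  near=> x => z Sz.
  apply: (passage_moment_ge1 Sigma_strip Z_markov s1 e0 W0 _ Sz) => y Sy xy.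
  apply: drift => //; apply: le_lt_trans xy; near: x.
  by apply: nbhs_pinfty_ge; rewrite num_real.
(* A slightly larger exponent than theta still satisfies the strict condition. *)
pose L := \sum_i (2 * c i + (2 * theta - 1) * s2 i) * pi i.
pose m := 1 + \sum_i s2 i * pi i.
have m0 : 0 < m.
  have [pi0 _ _] := pi_stat.
  by rewrite ltr_wpDr// sumr_ge0// => i _; rewrite mulr_ge0.
pose theta' := theta - L / (4 * m).
have theta'E : theta' - theta = - L / (4 * m) by rewrite /theta'; ring.
have theta'_gt : theta < theta'.
  by rewrite -subr_gt0 theta'E divr_gt0 ?oppr_gt0 ?mulr_gt0.
pose t := Num.min theta' 1.
have t1 : t <= 1 by rewrite ge_min lexx orbT.
have st : s < t by rewrite lt_min s1 (le_lt_trans s_theta).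
have t_neg : \sum_i (2 * c i + (2 * t - 1) * s2 i) * pi i < 0.
  apply: (@le_lt_trans _ _ (L + 2 * (theta' - theta) * m)).
    have -> : 2 * (theta' - theta) * m = 2 * (theta' - theta) +
        \sum_i (2 * (theta' - theta)) * (s2 i * pi i).
      by rewrite -mulr_sumr /m; ring.
    rewrite addrCA -big_split/= -[leLHS]add0r lerD//; first by lra.
    apply: ler_sum => i _; have [pi0 _ _] := pi_stat.
    have : (2 * t - 2 * theta') * (s2 i * pi i) <= 0.
      rewrite mulr_le0_ge0 ?mulr_ge0//.
      have : t <= theta' by rewrite ge_min lexx.
      lra.
    lra.
  rewrite theta'E; have -> : L + 2 * (- L / (4 * m)) * m = L / 2.
    by field; rewrite gt_eqF.
  by move: theta_drift; rewrite -/L; lra.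
have t0 : 0 < t by exact: lt_trans st.
have tp : 2 * t <= p by lra.
have [W [e [x0 [e0 W0 drift]]]] := lyapunov_exists t t0 tp t_neg.
near=> x => z Sz.
apply: (passage_moment_lt1 Sigma_strip Z_markov s_gt0 st t1 e0 W0 _ Sz) => y Sy xy.
apply: drift => //; apply: le_lt_trans xy; near: x.
by apply: nbhs_pinfty_ge; rewrite num_real.
Unshelve. all: by end_near.
Qed.
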